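(* Let $f\in L^2(I)\setminus\mathcal A^{\psi,b}|_I$ and $h\in L^2(J)$. For $\mu>-1$ let $$g_0(\mu)=(1+\mu\phi)^{-1}P_+\left(\bar b(f-\psi)\vee(1+\mu)\bar b(h-\psi)\right),$$ $$M_0(\mu)=\|\psi+bg_0(\mu)-h\|_{L^2(J)},\qquad e(\mu)=\|\psi+bg_0(\mu)-f\|_{L^2(I)}^2 .$$ Then for all $\mu>-1$ $$\frac{de}{d\mu}>0,\qquad \frac{dM_0^2}{d\mu}<0,$$ and moreover $$\frac{de}{d\mu}=-(\mu+1)\frac{dM_0^2}{d\mu}.$$
   Context: $\mathbb D$ is the open unit disk of $\mathbb C$ and $\mathbb T$ the unit circle. $\mathbb T=I\cup J$ where $I$ and $J=\mathbb T\setminus I$ are Lebesgue measurable sets, both of positive measure. $L^2$ spaces on $\mathbb T$, $I$, $J$ are taken with respect to the normalized measure $\frac{1}{2\pi}d\theta$. $H^2$ is the Hardy space of the disk, identified through boundary values with the closed subspace of $L^2(\mathbb T)$ of functions whose Fourier coefficients of negative index vanish; $P_+:L^2(\mathbb T)\to H^2$ is the orthogonal projection. For $u$ on $I$ and $v$ on $J$, $u\vee v$ denotes the function on $\mathbb T$ equal to $u$ on $I$ and to $v$ on $J$ (functions defined on all of $\mathbb T$ being restricted). $z_1,\dots,z_N\in\mathbb D$ are distinct points, $\omega_1,\dots,\omega_N\in\mathbb C$, $\psi\in H^2$ is a fixed function with $\psi(z_j)=\omega_j$ for all $j$, and $b(z)=e^{i\phi_0}\prod_{j=1}^N\frac{z-z_j}{1-\bar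 z_jz}$ ($\phi_0\in[0,2\pi]$ constant). $\mathcal A^{\psi,b}=\{\psi+bg:\ g\in H^2\}$ and $\mathcal A^{\psi,b}|_I$ is the set of restrictions (traces) to $I$ of its elements. $\phi:H^2\to H^2$, $\phi(F)=P_+(\chi_JF)$, is the Toeplitz operator with symbol the indicator function $\chi_J$; it is self-adjoint with spectrum contained in $[0,1]$, so $1+\mu\phi$ is boundedly invertible on $H^2$ for $\mu>-1$. *)

(* Defs.v *)
From HB Require Import structures.
From mathcomp Require Import all_boot all_order all_algebra.
From mathcomp Require Import complex.
From mathcomp Require Import all_classical all_reals all_analysis.

Set Implicit Arguments.
Unset Strict Implicit.
Unset Printing Implicit Defensive.
Import Order.TTheory GRing.Theory Num.Theory.
Import numFieldNormedType.Exports.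
Local Open Scope classical_set_scope.
Local Open Scope ring_scope.
Local Open Scope complex_scope.

(* The circle is parametrized by its angle: a function on the circle is a
   function R -> R[i] of which only the values on [0, 2 pi[ matter. Elements of
   L^2 are represented by such functions, two of them being the same element
   when they are equal almost everywhere. *)
Definition circle (R : realType) : set R := `[0, 2 * pi[.
Arguments circle : clear implicits.

Definition expi (R : realType) (t : R) : R[i] := Complex (cos t) (sin t).

Definition normc (R : realType) (z : R[i]) : R := ComplexField.Normc.normc z.

(* [lebT R] is R with the sigma-algebra of all Lebesgue measurable sets, and not
   only the Borel ones; [Leb R] is the (complete) Lebesgue measure on it. *)
Notation lebT R :=
  (caratheodory_type ((wlength (@idfun (Real.sort R)))^*)%mu).
Notation Leb R := (@completed_lebesgue_measure R).

Definition lebesgue_measurable (R : realType) (A : set R) : Prop :=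
  measurable (A : set (lebT R)).

Definition cmeasurable_fun (R : realType) (A : set R) (u : R -> R[i]) : Prop :=
  measurable_fun (A : set (lebT R)) ((fun t => complex.Re (u t)) : lebT R -> R)
  /\
  measurable_fun (A : set (lebT R)) ((fun t => complex.Im (u t)) : lebT R -> R).

Definition L2 (R : realType) (A : set R) (u : R -> R[i]) : Prop :=
  cmeasurable_fun A u /\
  (\int[Leb R]_(t in A) (normc (u t) ^+ 2)%:E < +oo)%E.

(* Integrals with respect to d theta / (2 pi). *)
Definition mean (R : realType) (A : set R) (u : R -> R) : R :=
  (2 * pi)^-1 * \int[Leb R]_(t in A) u t.

Definition cmean (R : realType) (A : set R) (u : R -> R[i]) : R[i] :=
  Complex (mean A (fun t => complex.Re (u t)))
          (mean A (fun t => complex.Im (u t))).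

Definition normL2 (R : realType) (A : set R) (u : R -> R[i]) : R :=
  Num.sqrt (mean A (fun t => normc (u t) ^+ 2)).

Definition inner (R : realType) (u v : R -> R[i]) : R[i] :=
  cmean (circle R) (fun t => u t * conjc (v t)).

Definition fourier (R : realType) (u : R -> R[i]) (n : int) : R[i] :=
  cmean (circle R) (fun t => u t * expi (- (n%:~R * t))).

Definition hardy2 (R : realType) (u : R -> R[i]) : Prop :=
  L2 (circle R) u /\ forall n : int, n < 0 -> fourier u n = 0.

(* Value at a point z of the disk of the holomorphic function whose boundary
   function is u: the sum of its Taylor series. *)
Definition disk_value (R : realType) (u : R -> R[i]) (z : R[i]) : R[i] :=
  limn (series (fun n : nat => fourier u n%:Z * z ^+ n) : nat -> R[i]^o).

Definition is_hardy_proj (R : realType) (u v : R -> R[i]) : Prop :=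
  hardy2 v /\ forall w, hardy2 w -> inner (fun t => u t - v t) w = 0.

(* The orthogonal projection P_+, determined by [is_hardy_proj] up to a.e.
   equality; [xget] selects a representative. *)
Definition Pplus (R : realType) (u : R -> R[i]) : R -> R[i] :=
  xget (fun=> 0) [set v | is_hardy_proj u v].

Definition toeplitz (R : realType) (J : set R) (u : R -> R[i]) : R -> R[i] :=
  Pplus (fun t => (\1_J t)%:C * u t).

(* (1 + mu phi)^-1 on the Hardy space, phi being the Toeplitz operator with
   symbol the indicator function of J; again [xget] selects a representative of
   an element that is unique up to a.e. equality when mu > -1. *)
Definition resolvent (R : realType) (J : set R) (mu : R) (u : R -> R[i]) :
    R -> R[i] :=
  xget (fun=> 0)
    [set g | hardy2 g /\
       ae_eq (Leb R) (circle R) (fun t => g t + mu%:C * toeplitz J g t) u].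

Definition vee (R : realType) (I : set R) (u v : R -> R[i]) : R -> R[i] :=
  fun t => if t \in I then u t else v t.

Definition blaschke (R : realType) (N : nat) (phi0 : R) (z_ : 'I_N -> R[i])
    (z : R[i]) : R[i] :=
  expi phi0 * \prod_(j < N) ((z - z_ j) / (1 - conjc (z_ j) * z)).

Definition interp (R : realType) (psi b : R -> R[i]) : set (R -> R[i]) :=
  [set F | exists2 g, hardy2 g & F = (fun t => psi t + b t * g t)].

Definition trace (R : realType) (I : set R) (A : set (R -> R[i])) :
    set (R -> R[i]) :=
  [set f | exists2 F, A F & ae_eq (Leb R) I f F].

(* Main.v *)
Require Import Defs.
From HB Require Import structures.
From mathcomp Require Import all_boot all_order all_algebra.
From mathcomp Require Import complex.
From mathcomp Require Import all_classical all_reals all_analysis.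
From mathcomp Require Import measurable_realfun ring lra.

Set Implicit Arguments.
Unset Strict Implicit.
Unset Printing Implicit Defensive.
Import Order.TTheory GRing.Theory Num.Theory.
Import numFieldNormedType.Exports.
Local Open Scope classical_set_scope.
Local Open Scope ring_scope.

(** Write lam = 1 + mu, and let q be the function equal to conj b (f - psi) on I
    and to conj b (h - psi) on J. Since |b| = 1 on the circle,
    e = ||g0 - q||_I^2 and M0^2 = ||g0 - q||_J^2, and the equation that defines
    g0 says exactly that g0 - q is orthogonal to H^2 for the weighted product
    <u, v>_lam = <u, v>_I + lam <u, v>_J; so g0 is the weighted projection of q
    on H^2 ([resolventP]), where q no longer depends on mu.

    Let k in H^2 satisfy <k, w>_lam = - <g0 - q, w>_J for all w in H^2
    ([derivative_direction]); k is the derivative of g0 in lam. Subtracting the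
    orthogonality relations at lam and at lam + h gives an exact expansion of
    both errors in which everything but the linear term is O(h^2), whence
      (M0^2)' = - 2 ||k||_lam^2   and   e' = 2 lam ||k||_lam^2
    ([weighted_derive]). This is pure algebra in a space with two positive
    semidefinite forms, and no derivative of a function with values in H^2
    appears. The identity e' = - lam (M0^2)' is then immediate.

    The strict signs need k <> 0. If k = 0 then g0 - q is orthogonal to H^2 both
    on J and on I. The conjugate of its restriction to I, extended by 0, is then
    a function of H^2 that vanishes on J, a set of positive measure; such a
    function is 0 ([hardy_uniqueness]), so that f = psi + b g0 on I, which is
    excluded ([derivative_direction_gt0]).

    The uniqueness theorem is proved in the manner of Beurling and Helson. After
    division by a power of z one may assume that the value at the origin is 1.
    Among the functions of H^2 that vanish on J and have value 1 at the origin
    let theta have the least norm. All theta + c z^n theta with n >= 1 compete,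
    hence theta is orthogonal to z^n theta: all the Fourier coefficients of
    |theta|^2 but the one of index 0 are 0. So |theta|^2 is constant almost
    everywhere; it vanishes on J, hence theta = 0, against its value at the
    origin.

    That last step is the uniqueness theorem for Fourier series of integrable
    functions ([fourier_uniqueness]). If w has no Fourier coefficient, the
    integral of w f is 0 for f a trigonometric polynomial, hence for every f in
    the closure of these under bounded limits almost everywhere; the closure
    contains all bounded measurable functions, and f = sgn w gives the claim.

    Projections (the one on H^2, the weighted ones, and theta) all come from the
    theorem of the closest point of a closed convex set ([proj_exists]), applied
    to L^2 of the circle, whose completeness is [sqint_complete]. *)

(** * Positive semidefinite forms and closest points *)

Definition lin_subspace (R : realType) (V : lmodType R) (K : set V) : Prop :=
  K 0 /\ forall (a : R) (u v : V), K u -> K v -> K (a *: u + v).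

(** The axioms are relative to a domain [D] because integrals are linear on
    integrable functions only. The form is not definite: the vectors below are
    functions, not classes modulo equality almost everywhere. *)
Record psd_form (R : realType) (V : lmodType R) (D : set V)
    (B : V -> V -> R) : Prop := PsdForm {
  psd_dom : lin_subspace D ;
  psd_sym : forall u v, D u -> D v -> B u v = B v u ;
  psd_lin : forall a u v w, D u -> D v -> D w ->
    B (a *: u + v) w = a * B u w + B v w ;
  psd_ge0 : forall u, D u -> 0 <= B u u }.

Definition form_cvg (R : realType) (V : lmodType R) (B : V -> V -> R)
    (x : nat -> V) (l : V) : Prop :=
  forall e : R, 0 < e -> exists n0 : nat, forall n, (n0 <= n)%N ->
    B (x n - l) (x n - l) <= e.

(** Only sequences with geometrically small increments are considered: these are
    what minimizing sequences provide, and they spare the extraction of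
    subsequences in the proof that L^2 is complete. *)
Definition form_complete (R : realType) (V : lmodType R) (D : set V)
    (B : V -> V -> R) : Prop :=
  forall (x : nat -> V) (C : R), (forall n, D (x n)) ->
    (forall n, B (x n.+1 - x n) (x n.+1 - x n) <= C * 4 ^- n) ->
    exists2 l, D l & form_cvg B x l.

Definition form_closed (R : realType) (V : lmodType R) (D : set V)
    (B : V -> V -> R) (K : set V) : Prop :=
  forall (x : nat -> V) (l : V), (forall n, K (x n)) -> D l ->
    form_cvg B x l -> K l.

Section subspace.
Variables (R : realType) (V : lmodType R) (K : set V).
Hypothesis subK : lin_subspace K.

Lemma subspaceZ a u : K u -> K (a *: u).
Proof. by move=> Ku; rewrite -[_ *: _]addr0; apply: subK.2 => //; exact: subK.1. Qed.

Lemma subspaceD u v : K u -> K v -> K (u + v).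
Proof. by move=> Ku Kv; rewrite -[u]scale1r; apply: subK.2. Qed.

Lemma subspaceN u : K u -> K (- u).
Proof. by move=> Ku; rewrite -scaleN1r; apply: subspaceZ. Qed.

Lemma subspaceB u v : K u -> K v -> K (u - v).
Proof. by move=> Ku Kv; apply: subspaceD => //; exact: subspaceN. Qed.

End subspace.

Section form_theory.
Variables (R : realType) (V : lmodType R) (D : set V) (B : V -> V -> R).
Hypothesis psdB : psd_form D B.

Let subD := psd_dom psdB.

Lemma psdDl u v w : D u -> D v -> D w -> B (u + v) w = B u w + B v w.
Proof.
by move=> Du Dv Dw; rewrite -[u in LHS]scale1r (psd_lin psdB)// mul1r.
Qed.

Lemma psdZl a u w : D u -> D w -> B (a *: u) w = a * B u w.
Proof.
move=> Du Dw; have D0 := subD.1.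
have B0 : B 0 w = 0.
  by apply: (addrI (B 0 w)); rewrite -psdDl// !addr0.
by rewrite -[_ *: _]addr0 (psd_lin psdB)// B0 addr0.
Qed.

Lemma psdNl u w : D u -> D w -> B (- u) w = - B u w.
Proof. by move=> Du Dw; rewrite -scaleN1r psdZl// mulN1r. Qed.

Lemma psdBl u v w : D u -> D v -> D w -> B (u - v) w = B u w - B v w.
Proof.
by move=> Du Dv Dw; rewrite psdDl ?psdNl//; exact: subspaceN.
Qed.

Lemma psdDr u v w : D u -> D v -> D w -> B w (u + v) = B w u + B w v.
Proof.
move=> Du Dv Dw; rewrite !(psd_sym psdB Dw)// ?psdDl//; exact: subspaceD.
Qed.

Lemma psdZr a u w : D u -> D w -> B w (a *: u) = a * B w u.
Proof.
by move=> Du Dw; rewrite !(psd_sym psdB Dw)// ?psdZl//; exact: subspaceZ.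
Qed.

Lemma psdNr u w : D u -> D w -> B w (- u) = - B w u.
Proof. by move=> Du Dw; rewrite -scaleN1r psdZr// mulN1r. Qed.

Lemma psdBr u v w : D u -> D v -> D w -> B w (u - v) = B w u - B w v.
Proof.
by move=> Du Dv Dw; rewrite psdDr ?psdNr//; exact: subspaceN.
Qed.

Lemma psd_sqD u v t : D u -> D v ->
  B (t *: v + u) (t *: v + u) = B u u + 2 * t * B u v + t ^+ 2 * B v v.
Proof.
move=> Du Dv; have Dtv := subspaceZ subD t Dv.
rewrite psdDl ?psdDr ?psdZl ?psdZr//; try exact: subspaceD.
by rewrite (psd_sym psdB Dv Du); ring.
Qed.

(** Cauchy-Schwarz: the polynomial t |-> B (u + t v) (u + t v) is nonnegative. *)
Lemma psd_CS u v : D u -> D v -> B u v ^+ 2 <= B u u * B v v.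
Proof.
move=> Du Dv.
have q t : 0 <= B u u + 2 * t * B u v + t ^+ 2 * B v v.
  rewrite -psd_sqD//; apply: (psd_ge0 psdB).
  by apply: subspaceD => //; exact: subspaceZ.
have [v0|v0] := eqVneq (B v v) 0.
  have [b0|b0] := eqVneq (B u v) 0; first by rewrite b0 v0 expr0n mulr0.
  (* when B v v = 0 the polynomial is affine; at this t it would be -1 *)
  have := q (- (1 + B u u) / (2 * B u v)).
  rewrite v0 mulr0 addr0.
  have -> : 2 * (- (1 + B u u) / (2 * B u v)) * B u v = - (1 + B u u).
    by field.
  by rewrite opprD addrCA subrr addr0 oppr_ge0 ler10.
have vp : 0 < B v v by rewrite lt0r v0 (psd_ge0 psdB).
have := q (- B u v / B v v).
have -> : B u u + 2 * (- B u v / B v v) * B u v + (- B u v / B v v) ^+ 2 * B v v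
   = (B u u * B v v - B u v ^+ 2) / B v v by field.
by rewrite pmulr_lge0 ?invr_gt0// subr_ge0.
Qed.

Lemma parallelogram u v : D u -> D v ->
  B (u - v) (u - v) = 2 * B u u + 2 * B v v
    - 4 * B (2^-1 *: (u + v)) (2^-1 *: (u + v)).
Proof.
move=> Du Dv; have Duv := subspaceD subD Du Dv.
rewrite psdZl ?psdZr ?psdBl ?psdBr ?psdDl ?psdDr//;
  try exact: subspaceB; try exact: subspaceZ.
by rewrite (psd_sym psdB Dv Du); field.
Qed.

End form_theory.

Section projection.
Variables (R : realType) (V : lmodType R) (D : set V) (B : V -> V -> R).
Hypotheses (psdB : psd_form D B) (cB : form_complete D B).
Let subD := psd_dom psdB.

(** Continuity of the norm, in terms of squares: if b = B (l - q) (l - q) exceeded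
    [m] by d > 0, a term at squared distance at most d^2 / (16 (b + 1)) from [l]
    would contradict the bound on the terms. *)
Lemma form_lim_le (x : nat -> V) l q m : (forall n, D (x n)) -> D l -> D q ->
  form_cvg B x l -> 0 <= m ->
  (forall n, B (x n - q) (x n - q) <= m + 4 ^- n) -> B (l - q) (l - q) <= m.
Proof.
move=> Dx Dl Dq xl m0 xm.
have Dlq := subspaceB subD Dl Dq.
have [//|mlt] := leP (B (l - q) (l - q)) m.
pose b := B (l - q) (l - q); pose d := b - m.
have d0 : 0 < d by rewrite subr_gt0.
have e0 : 0 < d ^+ 2 / (16 * (b + 1)).
  by rewrite divr_gt0 ?exprn_gt0// mulr_gt0// addr_gt0// (le_lt_trans m0 mlt).
have [n0 Hn0] := xl _ e0.
have [n1 Hn1] : exists n1, forall n, (n1 <= n)%N -> 4 ^- n < d / 4 :> R.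
  have : (fun n => (4^-1 : R) ^+ n) @ \oo --> 0.
    by apply: cvg_expr; rewrite ger0_norm ?invr_ge0// invf_lt1// ltr1n.
  move=> /cvgrPdist_lt /(_ (d / 4)) []; first by rewrite divr_gt0.
  move=> n1 _ H; exists n1 => n /H/=.
  by rewrite sub0r normrN ger0_norm ?exprn_ge0 ?invr_ge0// exprVn.
pose n := maxn n0 n1.
have := Hn0 n (leq_maxl _ _); have := Hn1 n (leq_maxr _ _).
set a := B (x n - l) (x n - l) => h1 h2.
have Dxl := subspaceB subD (Dx n) Dl.
have eq1 : B (x n - q) (x n - q) = b + 2 * B (l - q) (x n - l) + a.
  have -> : x n - q = 1 *: (x n - l) + (l - q).
    by rewrite scale1r addrA subrK.
  by rewrite (psd_sqD psdB)// expr1n mulr1 mul1r.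
have := psd_CS psdB Dlq Dxl; rewrite -/a -/b => cs.
have := xm n; rewrite eq1 => h3.
have a0 : 0 <= a by exact: (psd_ge0 psdB).
have b0 : 0 < b by exact: le_lt_trans mlt.
have cs2 : B (l - q) (x n - l) ^+ 2 <= (d / 4) ^+ 2.
  apply: (le_trans cs); apply: (@le_trans _ _ (b * (d ^+ 2 / (16 * (b + 1))))).
    by rewrite ler_pM2l.
  rewrite mulrA ler_pdivrMr; last by lra.
  have -> : (d / 4) ^+ 2 * (16 * (b + 1)) = b * d ^+ 2 + d ^+ 2 by field.
  by rewrite lerDl sqr_ge0.
have : - (d / 4) <= B (l - q) (x n - l).
  have : `|B (l - q) (x n - l)| <= d / 4.
    have d40 : 0 <= d / 4 by lra.
    by rewrite -ler_sqr ?nnegrE ?normr_ge0// real_normK ?num_real.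
  by rewrite ler_norml => /andP[].
by move: d0 h1 h3; rewrite /d; lra.
Qed.

(** The parallelogram identity makes a minimizing sequence Cauchy: the midpoint
    of two almost minimizers cannot be closer to [q] than the infimum. *)
Theorem proj_exists (K : set V) (x0 q : V) : K `<=` D ->
  (forall x y, K x -> K y -> K (2^-1 *: (x + y))) ->
  form_closed D B K -> K x0 -> D q ->
  exists2 x, K x & forall y, K y -> B (x - q) (x - q) <= B (y - q) (y - q).
Proof.
move=> KD Kc Kcl Kx0 Dq.
pose S := [set B (y - q) (y - q) | y in K].
have Dyq y : K y -> D (y - q) by move=> /KD Dy; exact: subspaceB.
have S0 : S !=set0 by exists (B (x0 - q) (x0 - q)), x0.
have Slb : has_lbound S by exists 0 => _ [y Ky <-]; exact/(psd_ge0 psdB)/Dyq.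
have hS : has_inf S by split.
pose m := inf S.
have m_le y : K y -> m <= B (y - q) (y - q).
  by move=> Ky; apply: ge_inf => //; exists y.
have m0 : 0 <= m.
  by apply: lb_le_inf => // _ [y Ky <-]; exact/(psd_ge0 psdB)/Dyq.
have ex n : exists y, K y /\ B (y - q) (y - q) <= m + 4 ^- n.
  have e0 : 0 < 4 ^- n :> R by rewrite invr_gt0 exprn_gt0.
  have [_ [y Ky <-] lty] := inf_adherent e0 hS.
  by exists y; split => //; exact: ltW.
have [x xP] := choice ex.
have Kx n := (xP n).1.
have Dx n := KD _ (Kx n).
have cau n : B (x n.+1 - x n) (x n.+1 - x n) <= 4 * 4 ^- n.
  have -> : x n.+1 - x n = (x n.+1 - q) - (x n - q).
    by rewrite opprB addrA subrK.
  rewrite (parallelogram psdB (Dyq _ (Kx _)) (Dyq _ (Kx _))).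
  have -> : 2^-1 *: (x n.+1 - q + (x n - q)) = 2^-1 *: (x n.+1 + x n) - q.
    rewrite addrACA -opprD scalerDr scalerN; congr (_ - _).
    by rewrite scalerDr -scalerDl [X in X *: _](_ : _ = 1) ?scale1r//; field.
  have h1 := m_le _ (Kc _ _ (Kx n.+1) (Kx n)).
  have h2 := (xP n.+1).2; have h3 := (xP n).2.
  have h4 : 4 ^- n.+1 <= 4 ^- n :> R.
    by rewrite lef_pV2 ?posrE ?exprn_gt0// exprS ler_peMl ?exprn_ge0 ?ler1n.
  by lra.
have [l Dl xl] := cB Dx cau.
have Kl := Kcl _ _ Kx Dl xl.
exists l => // y Ky; apply: le_trans (m_le _ Ky).
by apply: (form_lim_le Dx Dl Dq xl m0) => n; exact: (xP n).2.
Qed.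

(** A first order condition: along the line of direction [w] the squared distance
    is a quadratic polynomial with its minimum at 0. *)
Lemma minimizer_orth (K : set V) x q w : K x -> D x -> D q -> D w ->
  (forall y, K y -> B (x - q) (x - q) <= B (y - q) (y - q)) ->
  (forall t : R, K (t *: w + x)) -> B (x - q) w = 0.
Proof.
move=> Kx Dx Dq Dw xmin Kt.
have Dxq := subspaceB subD Dx Dq.
have h t : 0 <= 2 * t * B (x - q) w + t ^+ 2 * B w w.
  have := xmin _ (Kt t); rewrite -addrA (psd_sqD psdB)//.
  by rewrite -addrA lerDl.
set b := B (x - q) w in h *; set c := B w w in h.
have c0 : 0 <= c by exact: (psd_ge0 psdB).
have := h (- b / (c + 1)).
have -> : 2 * (- b / (c + 1)) * b + (- b / (c + 1)) ^+ 2 * c =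
          - (b ^+ 2 * (c + 2) / (c + 1) ^+ 2) by field; lra.
rewrite oppr_ge0 pmulr_lle0; last by rewrite invr_gt0 exprn_gt0//; lra.
rewrite pmulr_lle0; last by lra.
by move=> b2; apply/eqP; rewrite -sqrf_eq0 eq_le b2 sqr_ge0.
Qed.

Lemma orth_proj (K : set V) q : lin_subspace K -> K `<=` D ->
  form_closed D B K -> D q ->
  exists2 x, K x & forall w, K w -> B (x - q) w = 0.
Proof.
move=> sK KD Kcl Dq.
have [|x Kx xmin] := proj_exists KD _ Kcl sK.1 Dq.
  by move=> x y Kx Ky; apply: subspaceZ => //; exact: subspaceD.
exists x => // w Kw; apply: (minimizer_orth Kx _ Dq _ xmin) => [||t].
- exact: KD.
- exact: KD.
- exact: sK.2.
Qed.

End projection.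

Lemma psd_formS (R : realType) (V : lmodType R) (D D' : set V) (F : V -> V -> R) :
  lin_subspace D' -> D' `<=` D -> psd_form D F -> psd_form D' F.
Proof.
move=> sD DD [_ s l g]; split => //.
- by move=> u v /DD Du /DD; exact: s.
- by move=> a u v w /DD Du /DD Dv /DD; exact: l.
- by move=> u /DD; exact: g.
Qed.

Lemma psd_form_add (R : realType) (V : lmodType R) (D : set V)
    (P Q : V -> V -> R) (lam : R) : psd_form D P -> psd_form D Q -> 0 <= lam ->
  psd_form D (fun u v => P u v + lam * Q u v).
Proof.
move=> psdP psdQ lam0; split.
- exact: psd_dom psdP.
- by move=> u v Du Dv; rewrite (psd_sym psdP Du Dv) (psd_sym psdQ Du Dv).
- move=> a u v w Du Dv Dw.
  by rewrite (psd_lin psdP a Du Dv Dw) (psd_lin psdQ a Du Dv Dw); ring.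
- by move=> u Du; rewrite addr_ge0 ?mulr_ge0 ?(psd_ge0 psdP) ?(psd_ge0 psdQ).
Qed.

(** ** Sets defined by linear equations *)

Section level_sets.
Variables (R : realType) (V : lmodType R) (D : set V) (B : V -> V -> R).
Hypothesis psdB : psd_form D B.
Let subD := psd_dom psdB.

(** [S] is a family of equations: the pairs (v, c) prescribe B u v = c. The Hardy
    space (vanishing Fourier coefficients) and the affine set used in the
    uniqueness theorem are both of this form, so that closedness and convexity
    are proved once. *)
Definition level_set (S : V -> R -> Prop) : set V :=
  [set u | D u /\ forall v c, S v c -> B u v = c].

Variable S : V -> R -> Prop.
Hypothesis SD : forall v c, S v c -> D v.

Lemma level_set_closed : form_closed D B (level_set S).
Proof.
move=> x l Kx Dl xl; split => // v c Svc; have Dv := SD Svc.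
have h n : B (x n - l) v ^+ 2 <= B (x n - l) (x n - l) * B v v.
  apply: (psd_CS psdB) => //; apply: (subspaceB subD) => //; exact: (Kx n).1.
have hE n : B (x n - l) v = c - B l v.
  by rewrite (psdBl psdB (Kx n).1 Dl Dv) ((Kx n).2 v c Svc).
apply/eqP; rewrite eq_sym -subr_eq0 -sqrf_eq0 eq_le sqr_ge0 andbT.
have [//|d0] := leP ((c - B l v) ^+ 2) 0.
have v0 : 0 <= B v v by exact: (psd_ge0 psdB).
set d := (c - B l v) ^+ 2 in d0 *.
have e0 : 0 < d / (2 * (B v v + 1)) by rewrite divr_gt0// mulr_gt0//; lra.
have [n0 Hn0] := xl _ e0; have := h n0; rewrite hE -/d.
have := Hn0 _ (leqnn n0); rewrite ler_pdivlMr; last by lra.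
set y := B (x n0 - l) (x n0 - l).
have y0 : 0 <= y.
  by apply: (psd_ge0 psdB); apply: (subspaceB subD) => //; exact: (Kx n0).1.
by nra.
Qed.

Lemma level_set_half x y : level_set S x -> level_set S y ->
  level_set S (2^-1 *: (x + y)).
Proof.
move=> [Dx Sx] [Dy Sy]; have Dxy := subspaceD subD Dx Dy.
split; first exact: subspaceZ.
move=> v c Svc; have Dv := SD Svc.
by rewrite (psdZl psdB) // (psdDl psdB)// (Sx _ _ Svc) (Sy _ _ Svc); field.
Qed.

Lemma level_set_subspace : (forall v c, S v c -> c = 0) -> lin_subspace (level_set S).
Proof.
move=> S0; have B0 v : D v -> B 0 v = 0.
  move=> Dv; rewrite -(scale0r 0) (psdZl psdB) ?mul0r//; exact: subD.1.
split.
  split; first exact: subD.1.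
  by move=> v c Svc; rewrite (S0 _ _ Svc) B0//; exact: SD Svc.
move=> a u v [Du Su] [Dv Sv]; split; first exact: subD.2.
move=> w c Swc; have Dw := SD Swc.
rewrite (psd_lin psdB)// (Su _ _ Swc) (Sv _ _ Swc).
by rewrite (S0 _ _ Swc) mulr0 addr0.
Qed.

End level_sets.

Section equivalent_forms.
Variables (R : realType) (V : lmodType R) (D : set V) (B B' : V -> V -> R).
Hypothesis (sD : lin_subspace D).
Variable (C C' : R).
Hypotheses (BB' : forall u, D u -> B u u <= C * B' u u)
           (B'B : forall u, D u -> B' u u <= C' * B u u).
Hypotheses (C0 : 0 < C) (C'0 : 0 < C').

(** The weighted forms are equivalent to the form of L^2, which transfers
    completeness and closedness to them. *)
Lemma form_complete_equiv : form_complete D B -> form_complete D B'.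
Proof.
move=> cB x M Dx xM.
have [||l Dl xl] := cB x (C * M).
- exact: Dx.
- move=> n; apply: (le_trans (BB' _)); first exact: subspaceB.
  by rewrite -mulrA ler_pM2l.
exists l => // e e0; have e0' : 0 < e / C' by rewrite divr_gt0.
have [n0 Hn0] := xl _ e0'; exists n0 => n /Hn0 h.
apply: (le_trans (B'B _)); first exact: subspaceB.
by rewrite mulrC -ler_pdivlMr.
Qed.

Lemma form_closed_equiv (K : set V) : K `<=` D ->
  form_closed D B K -> form_closed D B' K.
Proof.
move=> KD cK x l Kx Dl xl; apply: cK (Kx) (Dl) _ => e e0.
have e0' : 0 < e / C by rewrite divr_gt0.
have [n0 Hn0] := xl _ e0'; exists n0 => n /Hn0 h.
apply: (le_trans (BB' _)); first by apply: subspaceB => //; exact: KD.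
by rewrite mulrC -ler_pdivlMr.
Qed.

End equivalent_forms.

(** * The derivative of a weighted projection *)
Lemma is_derive_quadratic (R : realType) (F : R -> R) (x L C d : R) : 0 < d ->
  (forall h, `|h| < d -> `|F (x + h) - F x - h * L| <= C * h ^+ 2) ->
  is_derive x 1 F L.
Proof.
move=> d0 H.
have cv : (fun h => h^-1 *: (F (h *: (1 : R) + x) - F x)) @ 0^' --> L.
  apply/cvgrPdist_le => e e0; near=> h.
  have h0 : h != 0 by near: h; exact: nbhs_dnbhs_neq.
  have -> : L - h^-1 *: (F (h *: (1 : R) + x) - F x) =
            - (h^-1 * (F (x + h) - F x - h * L)).
    rewrite /GRing.scale/= mulr1 (addrC h x) [in RHS]mulrBr mulrA mulVf// mul1r.
    by rewrite opprB.
  rewrite normrN normrM normfV ler_pdivrMl ?normr_gt0//.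
  have hd : `|h| < d.
    near: h; apply: dnbhs0_lt; exact: d0.
  apply: (le_trans (H _ hd)); rewrite -[h ^+ 2]real_normK ?num_real// expr2.
  rewrite mulrC -mulrA ler_pM2l ?normr_gt0//.
  have C1 : 0 < `|C| + 1 by rewrite ltr_wpDl.
  have he : `|h| < e / (`|C| + 1).
    by near: h; apply: dnbhs0_lt; rewrite divr_gt0.
  apply: (@le_trans _ _ (`|h| * (`|C| + 1))).
    by rewrite ler_wpM2l//; have := ler_norm C; lra.
  by rewrite -ler_pdivlMr// ltW.
apply: DeriveDef; first by apply/cvg_ex; exists L.
exact: cvg_lim.
Unshelve. all: by end_near. Qed.

(** [g l] is the projection of [q] on [K] for the form P + l Q. Differentiating
    (P + l Q) (g l - q) w = 0 in [l] at [lam] formally gives the equation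
    [k_orth] for the derivative [k]. *)
Section weighted_projection.
Variables (R : realType) (V : lmodType R) (D : set V) (P Q : V -> V -> R).
Hypotheses (psdP : psd_form D P) (psdQ : psd_form D Q).
Variables (K : set V) (q : V) (g : R -> V) (lam : R) (k : V).
Hypotheses (sK : lin_subspace K) (KD : K `<=` D) (Dq : D q).
Hypothesis Kg : forall l, 0 < l -> K (g l).
Hypothesis g_orth : forall l w, 0 < l -> K w ->
  P (g l - q) w + l * Q (g l - q) w = 0.
Hypotheses (lam0 : 0 < lam) (Kk : K k).
Hypothesis k_orth : forall w, K w -> P k w + lam * Q k w = - Q (g lam - q) w.

Let subD := psd_dom psdP.
Let nk := P k k + lam * Q k k.

(** With d = g (lam + h) - g lam, the difference of the orthogonality relations is
    (P + (lam + h) Q) d w = - h Q (g lam - q) w on [K]. Taking w = k, and w = d in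
    the equation of [k], evaluates Q (g lam - q) d as h (Q d k - nk), which is all
    that the expansions of the squares require. *)
Lemma weighted_increment h : `|h| < lam / 2 ->
  let d := g (lam + h) - g lam in
  [/\ Q (g (lam + h) - q) (g (lam + h) - q) - Q (g lam - q) (g lam - q)
        = - (2 * h * nk) + (2 * h * Q d k + Q d d),
      P (g (lam + h) - q) (g (lam + h) - q) - P (g lam - q) (g lam - q)
        = 2 * lam * h * nk + (P d d - 2 * lam * h * Q d k)
    & P d d + (lam + h) * Q d d = - h * Q (g lam - q) d].
Proof.
move=> hl d.
have lh0 : 0 < lam + h by move: hl; rewrite ltr_norml => /andP[]; lra.
have Kd : K d by apply: subspaceB => //; exact: Kg.
have Dd := KD Kd; have Dg := KD (Kg lam0); have Dgh := KD (Kg lh0).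
have Dk := KD Kk.
have Dgq := subspaceB subD Dg Dq.
have split_ : g (lam + h) - q = 1 *: d + (g lam - q).
  by rewrite scale1r addrA subrK.
have o1 := g_orth lam0 Kd.
have inc w : K w -> P d w + (lam + h) * Q d w = - h * Q (g lam - q) w.
  move=> Kw; have Dw := KD Kw.
  have := g_orth lh0 Kw; rewrite split_ scale1r (psdDl psdP Dd Dgq Dw) (psdDl psdQ Dd Dgq Dw).
  by have := g_orth lam0 Kw; lra.
have kd : P k d + lam * Q k d = - Q (g lam - q) d := k_orth Kd.
have kk : nk = - Q (g lam - q) k := k_orth Kk.
have dk := inc _ Kk.
have sP := psd_sym psdP Dd Dk; have sQ := psd_sym psdQ Dd Dk.
have key : Q (g lam - q) d = h * Q d k - h * nk.
  by move: kk kd dk; rewrite -sP -sQ => kk kd dk; rewrite kk; lra.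
have sQ2 : Q (g lam - q) d = Q d (g lam - q) by exact: (psd_sym psdQ).
split; last exact: inc.
- by rewrite split_ (psd_sqD psdQ)// expr1n !mulr1 key; ring.
- rewrite split_ (psd_sqD psdP)// expr1n !mulr1.
  have -> : P (g lam - q) d = - lam * Q (g lam - q) d by lra.
  by rewrite key; ring.
Qed.

(** Taking w = d in the same relation bounds the weighted square norm of d by
    |h| |Q (g lam - q) d|, hence, by Cauchy-Schwarz, by a multiple of |h| times
    the norm of d: so d is O(h). For |h| < lam / 2 the weight lam + h stays above
    lam / 2, which makes the constants uniform. *)
Lemma weighted_increment_le : exists C, forall h, `|h| < lam / 2 ->
  let d := g (lam + h) - g lam in
  [/\ P d d <= C * h ^+ 2, Q d d <= C * h ^+ 2 & `|Q d k| <= C * `|h|].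
Proof.
pose a := Q (g lam - q) (g lam - q).
have Dg := KD (Kg lam0); have Dk := KD Kk.
have Dgq := subspaceB subD Dg Dq.
have a0 : 0 <= a by exact: (psd_ge0 psdQ).
pose C1 := a / (lam / 2); pose b := Q k k.
have b0 : 0 <= b by exact: (psd_ge0 psdQ).
have l20 : 0 < lam / 2 by rewrite divr_gt0.
have C10 : 0 <= C1 by rewrite divr_ge0// ltW.
pose C2 := C1 / (lam / 2).
have C20 : 0 <= C2 by rewrite divr_ge0// ltW.
exists (C1 + C2 + (C2 * b + 1)) => h hl d.
have [_ _] := weighted_increment hl; rewrite -/d => inc.
have lh0 : 0 < lam + h by move: hl; rewrite ltr_norml => /andP[]; lra.
have Dd : D d by apply: KD; apply: (subspaceB sK); exact: Kg.
have Pd0 := psd_ge0 psdP Dd; have Qd0 := psd_ge0 psdQ Dd.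
have cs := psd_CS psdQ Dgq Dd; rewrite -/a in cs.
set y := Q (g lam - q) d in inc cs.
have lQ : lam / 2 * Q d d <= - h * y.
  rewrite -inc; have : lam / 2 * Q d d <= (lam + h) * Q d d.
    apply: ler_wpM2r => //; move: hl; rewrite ltr_norml => /andP[]; lra.
  by lra.
have hy : (- h * y) ^+ 2 <= h ^+ 2 * (a * Q d d).
  by rewrite exprMn sqrrN; apply: ler_wpM2l; rewrite ?sqr_ge0.
have hy0 : 0 <= - h * y by apply: le_trans lQ; rewrite mulr_ge0// ltW.
have hyC : - h * y <= C1 * h ^+ 2.
  have [->|yn0] := eqVneq (- h * y) 0; first by rewrite mulr_ge0// sqr_ge0.
  have yp : 0 < - h * y by rewrite lt0r yn0.
  have : (- h * y) * (- h * y) <= (C1 * h ^+ 2) * (- h * y).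
    rewrite -expr2 (le_trans hy)//.
    have -> : h ^+ 2 * (a * Q d d) = (C1 * h ^+ 2) * (lam / 2 * Q d d).
      by rewrite /C1; field; lra.
    by apply: ler_wpM2l => //; rewrite mulr_ge0// sqr_ge0.
  by rewrite ler_pM2r.
have hsq : 0 <= h ^+ 2 by exact: sqr_ge0.
have QC : Q d d <= C2 * h ^+ 2.
  rewrite /C2 mulrAC ler_pdivlMr// mulrC; exact: le_trans hyC.
have Cb : 0 <= C2 * b by exact: mulr_ge0.
have lhQ : 0 <= (lam + h) * Q d d by rewrite mulr_ge0// ltW.
split.
- apply: (@le_trans _ _ (C1 * h ^+ 2)); first by lra.
  by apply: ler_wpM2r => //; lra.
- by apply: (le_trans QC); apply: ler_wpM2r => //; lra.
- apply: (@le_trans _ _ ((C2 * b + 1) * `|h|)); last first.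
    by apply: ler_wpM2r => //; lra.
  rewrite -ler_sqr ?nnegrE ?mulr_ge0//; last by lra.
  rewrite real_normK ?num_real// exprMn real_normK ?num_real//.
  apply: (le_trans (psd_CS psdQ Dd Dk)); rewrite -/b.
  apply: (@le_trans _ _ (C2 * b * h ^+ 2)).
    by rewrite mulrAC; apply: ler_wpM2r.
  apply: ler_wpM2r => //; rewrite sqrrD mulr1 expr1n.
  have := sqr_ge0 (C2 * b); lra.
Qed.

(** The remainders in [weighted_increment] are products of two factors that are
    O(h), hence quadratic. *)
Lemma weighted_derive :
  is_derive lam 1 (fun l => Q (g l - q) (g l - q)) (- (2 * nk)) /\
  is_derive lam 1 (fun l => P (g l - q) (g l - q)) (2 * lam * nk).
Proof.
have [C HC] := weighted_increment_le.
have l20 : 0 < lam / 2 by rewrite divr_gt0.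
split.
- apply: (@is_derive_quadratic _ _ _ _ (3 * C) _ l20) => h hl.
  have [-> _ _] := weighted_increment hl.
  have [_ h1 h2] := HC _ hl.
  set y := Q _ k in h2 *; set z := Q (_ - _) (_ - _) in h1 *.
  have z0 : 0 <= z.
    apply: (psd_ge0 psdQ); apply: (subspaceB subD); apply/KD/Kg => //.
    by move: hl; rewrite ltr_norml => /andP[]; lra.
  have -> : - (2 * h * nk) + (2 * h * y + z) - h * - (2 * nk) = 2 * h * y + z.
    by ring.
  apply: (le_trans (ler_normD _ _)); rewrite (ger0_norm z0).
  rewrite !normrM ger0_norm//.
  have : `|h| * `|y| <= C * h ^+ 2.
    rewrite -[h ^+ 2]real_normK ?num_real// expr2 mulrCA.
    by apply: ler_wpM2l.
  by lra.
- apply: (@is_derive_quadratic _ _ _ _ ((1 + 2 * lam) * C) _ l20) => h hl.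
  have [_ -> _] := weighted_increment hl.
  have [h1 _ h2] := HC _ hl.
  set y := Q _ k in h2 *; set z := P (_ - _) (_ - _) in h1 *.
  have z0 : 0 <= z.
    apply: (psd_ge0 psdP); apply: (subspaceB subD); apply/KD/Kg => //.
    by move: hl; rewrite ltr_norml => /andP[]; lra.
  have -> : 2 * lam * h * nk + (z - 2 * lam * h * y) - h * (2 * lam * nk)
     = z - 2 * lam * (h * y) by ring.
  apply: (le_trans (ler_normB _ _)); rewrite (ger0_norm z0).
  rewrite normrM (normrM h) (@ger0_norm _ (2 * lam)); last by lra.
  have hy : `|h| * `|y| <= C * h ^+ 2.
    rewrite -[h ^+ 2]real_normK ?num_real// expr2 mulrCA.
    by apply: ler_wpM2l.
  have : 2 * lam * (`|h| * `|y|) <= 2 * lam * (C * h ^+ 2).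
    by apply: ler_wpM2l => //; lra.
  by lra.
Qed.

End weighted_projection.

Lemma is_derive_translate (R : realType) (F : R -> R) (x c L : R) :
  is_derive (c + x) 1 F L -> is_derive x 1 (fun y => F (c + y)) L.
Proof.
move=> dF.
have dg : is_derive x 1 (fun y : R => c + y) 1.
  by have dD := is_deriveD (is_derive_cst c x 1) (is_derive_id x 1); rewrite add0r in dD.
by have := is_derive1_comp dF dg; rewrite mulr1.
Qed.

(** * Square integrable functions on a set of finite measure *)
Section square_integrable.
Context d (T : measurableType d) (R : realType).
Variables (mu : {measure set T -> \bar R}) (D : set T).
Hypotheses (mD : measurable D) (finD : (mu D < +oo)%E).

Implicit Types (a b : T -> R).

Definition sqint (a : T -> R) : Prop :=
  measurable_fun D a /\ (\int[mu]_(t in D) ((a t) ^+ 2)%:E < +oo)%E.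

Lemma sqint_sq_integrable a : sqint a ->
  mu.-integrable D (fun t => ((a t) ^+ 2)%:E).
Proof.
move=> [ma ia]; apply/integrableP; split.
  by apply/measurable_EFinP; exact: measurable_funX.
by under eq_integral do rewrite gee0_abs ?lee_fin ?sqr_ge0//.
Qed.

Lemma sqint_mul a b : sqint a -> sqint b ->
  mu.-integrable D (fun t => (a t * b t)%:E).
Proof.
move=> sa sb.
apply: (@le_integrable _ _ _ mu D mD _
    (fun t => ((a t) ^+ 2)%:E + ((b t) ^+ 2)%:E)%E).
- by apply/measurable_EFinP; exact: measurable_funM sa.1 sb.1.
- move=> t _; rewrite -EFinD !abse_EFin lee_fin.
  rewrite [leRHS]ger0_norm ?addr_ge0 ?sqr_ge0//.
  rewrite ler_norml; apply/andP; split.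
    by have := sqr_ge0 (a t + b t); have := sqr_ge0 (a t); have := sqr_ge0 (b t); nra.
  by have := sqr_ge0 (a t - b t); have := sqr_ge0 (a t); have := sqr_ge0 (b t); nra.
- by apply: integrableD => //; exact: sqint_sq_integrable.
Qed.

Lemma sqint_le a b : measurable_fun D a -> sqint b ->
  (forall t, D t -> a t ^+ 2 <= b t ^+ 2) -> sqint a.
Proof.
move=> ma [mb ib] ab; split => //; apply: le_lt_trans ib.
apply: ge0_le_integral => //.
- by move=> t _; rewrite lee_fin sqr_ge0.
- by apply/measurable_EFinP; exact: measurable_funX.
- by apply/measurable_EFinP; exact: measurable_funX.
Qed.

Lemma sqintZ (k : R) a : sqint a -> sqint (fun t => k * a t).
Proof.
move=> sa; have [ma ia] := sa; split.
  by apply: measurable_funM => //; exact: measurable_cst.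
under eq_integral do rewrite exprMn EFinM.
rewrite integralZl//; last exact: sqint_sq_integrable.
by rewrite lte_mul_pinfty// lee_fin sqr_ge0.
Qed.

Lemma sqintD a b : sqint a -> sqint b -> sqint (fun t => a t + b t).
Proof.
move=> sa sb; split; first exact: measurable_funD sa.1 sb.1.
have : mu.-integrable D
    (fun t => (a t ^+ 2)%:E + (b t ^+ 2)%:E + (2 * (a t * b t))%:E)%E.
  apply: integrableD => //.
    by apply: integrableD => //; exact: sqint_sq_integrable.
  have /(integrableZl mD 2) := sqint_mul sa sb.
  by apply: eq_integrable.
move=> /(integrable_lty mD); congr (_ < _)%E; apply: eq_integral => t _.
by rewrite -!EFinD; congr EFin; ring.
Qed.

Lemma sqintB a b : sqint a -> sqint b -> sqint (fun t => a t - b t).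
Proof.
move=> sa /(sqintZ (-1)) sb; have := sqintD sa sb.
by under eq_fun do rewrite mulN1r.
Qed.

Lemma sqint_cst (k : R) : sqint (fun=> k).
Proof.
split; first exact: measurable_cst.
by rewrite integral_cst// lte_mul_pinfty// lee_fin sqr_ge0.
Qed.

Lemma integral_le_lty (f g : T -> R) :
  measurable_fun D f -> measurable_fun D g ->
  (forall t, D t -> 0 <= f t <= g t) ->
  (\int[mu]_(t in D) (g t)%:E < +oo)%E -> (\int[mu]_(t in D) (f t)%:E < +oo)%E.
Proof.
move=> mf mg fg; apply: le_lt_trans; apply: ge0_le_integral => //.
- by move=> t /fg /andP[f0 _]; rewrite lee_fin.
- exact/measurable_EFinP.
- exact/measurable_EFinP.
- by move=> t /fg /andP[_ ?]; rewrite lee_fin.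
Qed.

Lemma sqint_pairP a b : sqint a /\ sqint b <->
  (measurable_fun D a /\ measurable_fun D b) /\
  (\int[mu]_(t in D) (a t ^+ 2 + b t ^+ 2)%:E < +oo)%E.
Proof.
split=> [[sa sb]|[[ma mb] i]].
- split; first by split; [exact: sa.1|exact: sb.1].
  have := integrableD mD (sqint_sq_integrable sa) (sqint_sq_integrable sb).
  by move=> /(integrable_lty mD).
- have m2 : measurable_fun D (fun t => a t ^+ 2 + b t ^+ 2).
    by apply: measurable_funD; exact: measurable_funX.
  split; split=> //; apply: (integral_le_lty _ m2 _ i).
  + exact: measurable_funX.
  + by move=> t _; rewrite sqr_ge0 lerDl sqr_ge0.
  + exact: measurable_funX.
  + by move=> t _; rewrite sqr_ge0 lerDr sqr_ge0.
Qed.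

Lemma sqint_bounded a M : measurable_fun D a ->
  (forall t, D t -> `|a t| <= M) -> sqint a.
Proof.
move=> ma aM; apply: (sqint_le ma (sqint_cst M)) => t Dt.
by rewrite -(real_normK (num_real (a t))) lerXn2r ?nnegrE// (le_trans _ (aM t Dt)).
Qed.

Lemma sqint_integrable a : sqint a -> mu.-integrable D (EFin \o a).
Proof.
move=> sa; have := sqint_mul sa (sqint_cst 1).
by apply: eq_integrable => // t _ /=; rewrite mulr1.
Qed.

(** Riesz-Fischer. The measure being finite, the L^2 bound on the increments is
    an L^1 bound, so their series converges absolutely almost everywhere, and
    Fatou's lemma bounds the distance to the limit. *)
Section completeness.
Variables (x : nat -> T -> R) (C : R).
Hypothesis sx : forall n, sqint (x n).
Hypothesis xC : forall n,
  \int[mu]_(t in D) ((x n.+1 t - x n t) ^+ 2) <= C * 4 ^- n.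

Let Esq (a : T -> R) := (\int[mu]_(t in D) (a t ^+ 2)%:E)%E.

Let Esq_fin a : sqint a -> Esq a = (\int[mu]_(t in D) (a t ^+ 2))%:E.
Proof.
move=> sa; rewrite /Rintegral fineK//.
exact/integrable_fin_num/sqint_sq_integrable.
Qed.

Let C0 : 0 <= C.
Proof.
have := xC 0; rewrite expr0 invr1 mulr1; apply: le_trans.
by apply: Rintegral_ge0 => t _; exact: sqr_ge0.
Qed.

Let K := C + fine (mu D).

Let L1bound n :
  (\int[mu]_(t in D) `|x n.+1 t - x n t|%:E <= (K * 2 ^- n)%:E)%E.
Proof.
have su : sqint (fun t => x n.+1 t - x n t) by exact: sqintB.
have p2 : 0 < 2 ^+ n :> R by exact: exprn_gt0.
(* |y| <= p y^2 + 1 / p, with p = 2^n balancing the two terms *)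
apply: (@le_trans _ _ (\int[mu]_(t in D)
   ((2 ^+ n)%:E * ((x n.+1 t - x n t) ^+ 2)%:E + (2 ^- n)%:E))%E).
  apply: ge0_le_integral => //.
  - by apply/measurable_EFinP; apply: measurableT_comp => //; exact: su.1.
  - apply/measurable_EFinP; apply: measurable_funD; last exact: measurable_cst.
    by apply: measurable_funM; [exact: measurable_cst|exact/measurable_funX/su.1].
  - move=> t _; rewrite -EFinM -EFinD lee_fin.
    set y := x n.+1 t - x n t; set p := 2 ^+ n in p2 *.
    have p0 : 0 <= p^-1 by rewrite invr_ge0 ltW.
    have -> : p * y ^+ 2 + p^-1 = `|y| + p * ((`|y| - p^-1 / 2) ^+ 2) + p^-1 * (3 / 4).
      by rewrite -(real_normK (num_real y)); field; rewrite gt_eqF.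
    have h1 : 0 <= p * (`|y| - p^-1 / 2) ^+ 2 by rewrite mulr_ge0 ?sqr_ge0// ltW.
    by rewrite -addrA lerDl addr_ge0// mulr_ge0//; lra.
rewrite integralD//; last 2 first.
- exact/integrableZl/sqint_sq_integrable.
- exact/sqint_integrable/sqint_cst.
rewrite integralZl//; last exact/sqint_sq_integrable.
rewrite [X in (_ * X)%E]Esq_fin// integral_cst//.
have -> : (mu D = (fine (mu D))%:E)%E by rewrite fineK// ge0_fin_numE.
rewrite -!EFinM -EFinD lee_fin /K mulrDl [X in _ <= _ + X]mulrC lerD2r.
have := xC n; rewrite -(ler_pM2l p2) => /le_trans; apply.
rewrite mulrCA ler_wpM2l//.
have -> : 4 ^- n = 2 ^- n * 2 ^- n :> R.
  by rewrite -!exprVn -exprMn; congr (_ ^+ _); field.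
by rewrite mulrA mulfV ?mul1r// gt_eqF.
Qed.

Let cvg_ae : {ae mu, forall t, D t -> cvgn (fun n => x n t)}.
Proof.
pose F t := (\sum_(0 <= n <oo) `|x n.+1 t - x n t|%:E)%E.
have mu_ n : measurable_fun D (fun t => `|x n.+1 t - x n t|%:E).
  apply/measurable_EFinP; apply: measurableT_comp => //.
  exact: (sqintB (sx n.+1) (sx n)).1.
have iF : mu.-integrable D F.
  apply/integrableP; split; first exact: ge0_emeasurable_sum.
  under eq_integral => t _ do rewrite gee0_abs ?nneseries_ge0//.
  rewrite integral_nneseries//.
  have /cvg_lim h := @cvg_geometric_eseries_half R (2 * K) 0.
  apply: (@le_lt_trans _ _ (\sum_(0 <= n <oo) (2 * K / (2 ^ (n + 1))%:R)%:E)%E).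
    apply: lee_nneseries => [n _ _|n _]; first exact: integral_ge0.
    apply: (le_trans (L1bound n)); rewrite lee_fin natrX addn1 exprS invfM.
    by rewrite mulrACA mulfV ?mul1r.
  by rewrite h ?ltry//; exact: ereal_hausdorff.
apply: filterS (integrable_ae mD iF) => t Ft Dt.
have {}Ft := Ft Dt.
have cs : cvgn (series (fun n => x n.+1 t - x n t)).
  apply: normed_cvg; apply: nondecreasing_is_cvgn.
    by apply: nondecreasing_series => n _ _ /=.
  exists (fine (F t)) => _ [n _ <-]; rewrite -lee_fin fineK//= /series/= -sumEFin.
  exact: nneseries_lim_ge.
have -> : (fun n => x n t) = (fun n => x 0%N t + series (fun n => x n.+1 t - x n t) n).
  by apply/funext => n; rewrite /series/= telescope_sumr// addrC subrK.
by apply: is_cvgD => //; exact: is_cvg_cst.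
Qed.

Let tail n k :
  \int[mu]_(t in D) ((x (n + k)%N t - x n t) ^+ 2) <= 4 * C * 4 ^- n.
Proof.
elim: k n => [|k IH] n.
  under eq_Rintegral do rewrite addn0 subrr expr0n/=.
  by rewrite Rintegral_cst// mul0r !mulr_ge0// invr_ge0 exprn_ge0.
pose a t := x n.+1 t - x n t; pose b t := x (n.+1 + k)%N t - x n.+1 t.
have sa : sqint a by exact: sqintB.
have sb : sqint b by exact: sqintB.
have ia := sqint_sq_integrable sa; have ib := sqint_sq_integrable sb.
have ia2 : mu.-integrable D (EFin \o (fun t => 2 * a t ^+ 2)).
  by apply: eq_integrable (integrableZl mD 2 ia).
have ib2 : mu.-integrable D (EFin \o (fun t => 2 * b t ^+ 2)).
  by apply: eq_integrable (integrableZl mD 2 ib).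
apply: (@le_trans _ _ (\int[mu]_(t in D) (2 * a t ^+ 2 + 2 * b t ^+ 2))).
  apply: le_Rintegral => //.
  - by apply: sqint_sq_integrable; exact: sqintB.
  - by apply: eq_integrable (integrableD mD ia2 ib2).
  - move=> t _; rewrite addnS -addSn.
    have -> : x (n.+1 + k)%N t - x n t = a t + b t by rewrite /a /b; ring.
    by have := sqr_ge0 (a t - b t); nra.
rewrite RintegralD// !RintegralZl//.
have := xC n; have := IH n.+1; rewrite -/(a _).
have -> : 4 ^- n.+1 = 4^-1 * 4 ^- n :> R by rewrite -!exprVn exprS.
by rewrite /a /b; lra.
Qed.

Lemma sqint_complete : exists2 l, sqint l & forall n,
  \int[mu]_(t in D) ((x n t - l t) ^+ 2) <= 4 * C * 4 ^- n.
Proof.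
(* the upper limit is measurable even where the sequence diverges *)
pose l t := fine (limn_esup (fun n => (x n t)%:E)).
have ml : measurable_fun D l.
  apply: measurableT_comp => //; apply: measurable_fun_limn_esup => n.
  by apply/measurable_EFinP; exact: (sx n).1.
have lE : {ae mu, forall t, D t -> (fun n => x n t) @ \oo --> l t}.
  apply: filterS cvg_ae => t ct /ct /cvg_ex[y xy].
  have : (fun n => (x n t)%:E) @ \oo --> y%:E.
    by apply: cvg_EFin => //; exact: nearW.
  by move=> /cvg_limn_einf_sup[_ yE]; rewrite /l yE.
have bound n : (Esq (fun t => x n t - l t)%R <= (4 * C * 4 ^- n)%:E)%E.
  pose f k t := ((x (n + k)%N t - x n t) ^+ 2)%:E.
  have mf k : measurable_fun D (f k).
    by apply/measurable_EFinP/measurable_funX; exact: (sqintB (sx _) (sx _)).1.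
  have f0 k t : D t -> (0 <= f k t)%E by move=> _; rewrite lee_fin sqr_ge0.
  have := fatou mu mD mf f0.
  move=> fat; apply: (@le_trans _ _ (\int[mu]_(t in D) limn_einf (f^~ t))%E).
    apply: ae_ge0_le_integral => //.
    - by move=> t _; rewrite lee_fin sqr_ge0.
    - by apply/measurable_EFinP/measurable_funX/measurable_funB => //; exact: (sx _).1.
    - move=> t Dt; rewrite limn_einf_lim; apply: lime_ge; first exact: is_cvg_einfs.
      apply: nearW => m; apply: le_ereal_inf_tmp => _ [k _ <-]; exact: f0.
    - apply: (@measurableT_comp _ _ _ _ _ _ (@oppe R)) => //.
      by apply: measurable_fun_limn_esup => k; exact: measurableT_comp.
    - apply: filterS lE => t lt Dt.
      have cx : (fun k => f k t) @ \oo --> ((l t - x n t) ^+ 2)%:E.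
        apply: cvg_EFin; first exact: nearW.
        have : (fun k => x (n + k)%N t) @ \oo --> l t.
          by have := lt Dt; rewrite -(cvg_shiftn n); under eq_fun do rewrite addnC.
        move=> cx; rewrite /f /=;
          apply: (@cvg_comp _ _ _ _ (fun y : R => y ^+ 2));
          last exact: exprn_continuous.
        by apply: cvgB => //; exact: cvg_cst.
      have [-> _] := cvg_limn_einf_sup cx.
      by rewrite lee_fin -sqrrN opprB.
  apply: (le_trans fat); apply: (le_trans (limn_einf_sup _)).
  rewrite limn_esup_lim; apply: lime_le; first exact: is_cvg_esups.
  apply: nearW => m; apply: ge_ereal_sup => _ [k _ <-].
  rewrite [X in (X <= _)%E](Esq_fin (sqintB (sx _) (sx _))) lee_fin.
  exact: tail.
have sl : sqint l.
  have s0 : sqint (fun t => x 0%N t - l t).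
    split; first by apply: measurable_funB => //; exact: (sx _).1.
    by apply: (le_lt_trans (bound 0%N)); rewrite ltry.
  have := sqintB (sx 0%N) s0; by under eq_fun do rewrite opprB addrC subrK.
exists l => // n; rewrite -lee_fin -(Esq_fin (sqintB (sx n) sl)); exact: bound.
Unshelve. all: by end_near. Qed.

End completeness.

Lemma ae_eq_Rintegral a b : measurable_fun D a -> measurable_fun D b ->
  {ae mu, forall t, D t -> a t = b t} ->
  \int[mu]_(t in D) a t = \int[mu]_(t in D) b t.
Proof.
move=> ma mb ab; congr fine; apply: ae_eq_integral => //.
- exact/measurable_EFinP.
- exact/measurable_EFinP.
- by apply: filterS ab => t h /h ->.
Qed.

Lemma sq_int_eq0 a : sqint a -> \int[mu]_(t in D) (a t ^+ 2) = 0 ->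
  {ae mu, forall t, D t -> a t = 0}.
Proof.
move=> sa a0.
have := (@ae_eq_integral_abs _ _ _ mu D mD (fun t => (a t ^+ 2)%:E) _).1.
move=> []//.
- by apply/measurable_EFinP/measurable_funX; exact: sa.1.
- under eq_integral do rewrite gee0_abs ?lee_fin ?sqr_ge0//.
  rewrite -[LHS]fineK; last exact/integrable_fin_num/sqint_sq_integrable.
  by congr EFin.
- move=> N [mN N0 sub]; exists N; split => // t Pt; apply: sub => /= H; apply: Pt.
  by move=> Dt; have := H Dt => /= -[] /eqP; rewrite sqrf_eq0 => /eqP.
Qed.

End square_integrable.

Lemma sqintS d (T : measurableType d) (R : realType)
    (mu : {measure set T -> \bar R}) (A B : set T) (a : T -> R) :
  measurable A -> measurable B -> B `<=` A -> sqint mu A a -> sqint mu B a.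
Proof.
move=> mA mB BA [ma ia]; split; first exact: measurable_funS ma.
apply: le_lt_trans ia; apply: ge0_subset_integral => //.
- by apply/measurable_EFinP; exact: measurable_funX.
- by move=> t _; rewrite lee_fin sqr_ge0.
Qed.

(** The functions that an integrable [w] annihilates are stable under bounded
    limits (dominated convergence); if the sign of [w] is one of them, then the
    integral of |w| is 0. *)
Section bounded_multipliers.
Context d (T : measurableType d) (R : realType).
Variables (mu : {measure set T -> \bar R}) (D : set T) (w : T -> R).
Hypotheses (mD : measurable D) (iw : mu.-integrable D (EFin \o w)).

Let mw : measurable_fun D w.
Proof. by apply/measurable_EFinP; exact: measurable_int iw. Qed.

Lemma bounded_mul_integrable (f : T -> R) M : measurable_fun D f ->
  (forall t, D t -> `|f t| <= M) -> mu.-integrable D (fun t => (f t * w t)%:E).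
Proof.
move=> mf fM; apply: (le_integrable mD _ _ (integrableZl mD M iw)).
  by apply/measurable_EFinP; exact: measurable_funM.
move=> t Dt; rewrite lee_fin/= !normrM ler_wpM2r//.
exact: le_trans (fM t Dt) (ler_norm _).
Qed.

Lemma bounded_cvg_integral (f_ : nat -> T -> R) (f : T -> R) M :
  (forall n, measurable_fun D (f_ n)) ->
  (forall n t, D t -> `|f_ n t| <= M) -> measurable_fun D f ->
  {ae mu, forall t, D t -> (fun n => f_ n t) @ \oo --> f t} ->
  (forall n, \int[mu]_(t in D) (f_ n t * w t)%:E = 0)%E ->
  (\int[mu]_(t in D) (f t * w t)%:E = 0)%E.
Proof.
move=> mf_ fM mf cf f0.
have [] := @dominated_convergence _ _ _ mu D mD
  (fun n t => (f_ n t * w t)%:E) (fun t => (f t * w t)%:E)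
  (fun t => `|(M%:E * (w t)%:E)|%E).
- by move=> n; apply/measurable_EFinP; exact: measurable_funM.
- by apply/measurable_EFinP; exact: measurable_funM.
- apply: filterS cf => t ct Dt; apply: cvg_EFin; first exact: nearW.
  by apply: cvgM; [exact: ct|exact: cvg_cst].
- by apply: integrable_abse; exact: integrableZl.
- apply: aeW => t n Dt /=; rewrite lee_fin/= !normrM ler_wpM2r//.
  exact: le_trans (fM n t Dt) (ler_norm _).
move=> _ _; under eq_fun do rewrite f0.
move=> h; apply/esym; apply: cvg_unique h; first exact: ereal_hausdorff.
exact: cvg_cst.
Qed.

Lemma sg_integral_eq0 : (\int[mu]_(t in D) (Num.sg (w t) * w t)%:E = 0)%E ->
  {ae mu, forall t, D t -> w t = 0}.
Proof.
move=> w0; have := (@ae_eq_integral_abs _ _ _ mu D mD (EFin \o w) _).1.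
move=> []//; first exact/measurable_EFinP.
  by rewrite -[RHS]w0; apply: eq_integral => t _; rewrite /= normrEsg.
by move=> N [mN N0 sub]; exists N; split => // t Pt; apply: sub => /= H; apply: Pt;
  move=> Dt; have [] := H Dt.
Qed.

End bounded_multipliers.

Local Open Scope complex_scope.

(** * Complex functions on the circle *)
Section complex_parts.
Variable R : realType.
Implicit Types x y : R[i].

Lemma ReD x y : complex.Re (x + y) = complex.Re x + complex.Re y.
Proof. by case: x y => ? ? []. Qed.

Lemma ImD x y : complex.Im (x + y) = complex.Im x + complex.Im y.
Proof. by case: x y => ? ? []. Qed.

Lemma ReN x : complex.Re (- x) = - complex.Re x.
Proof. by case: x. Qed.

Lemma ImN x : complex.Im (- x) = - complex.Im x.
Proof. by case: x. Qed.

Lemma ReZ (a : R) (x : Rcomplex R) : complex.Re (a *: x) = a * complex.Re x.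
Proof. by case: x. Qed.

Lemma ImZ (a : R) (x : Rcomplex R) : complex.Im (a *: x) = a * complex.Im x.
Proof. by case: x. Qed.

Lemma ReM x y :
  complex.Re (x * y) = complex.Re x * complex.Re y - complex.Im x * complex.Im y.
Proof. by case: x y => ? ? []. Qed.

Lemma ImM x y :
  complex.Im (x * y) = complex.Re x * complex.Im y + complex.Im x * complex.Re y.
Proof. by case: x y => ? ? []. Qed.

Lemma ReJ x : complex.Re (conjc x) = complex.Re x.
Proof. by case: x. Qed.

Lemma ImJ x : complex.Im (conjc x) = - complex.Im x.
Proof. by case: x. Qed.

Lemma normc_sq x : normc x ^+ 2 = complex.Re x ^+ 2 + complex.Im x ^+ 2.
Proof. by case: x => a b; rewrite sqr_sqrtr// addr_ge0 ?sqr_ge0. Qed.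

Lemma normc_ge0 x : 0 <= normc x.
Proof. by case: x => a b; exact: sqrtr_ge0. Qed.

Lemma normc_sqM x y : normc (x * y) ^+ 2 = normc x ^+ 2 * normc y ^+ 2.
Proof. by rewrite !normc_sq ReM ImM; ring. Qed.

Lemma complex_eq x y :
  complex.Re x = complex.Re y -> complex.Im x = complex.Im y -> x = y.
Proof. by case: x y => a b [c d] /= -> ->. Qed.

End complex_parts.

Definition ReImE := (ReD, ImD, ReN, ImN, ReZ, ImZ, ReM, ImM, ReJ, ImJ).

Section circle_measure.
Variable R : realType.
Implicit Types A B : set R.

Lemma borel_lebesgue_measurable A :
  measurable (A : set R) -> lebesgue_measurable A.
Proof. by move=> mA; apply: sub_caratheodory; exact: mA. Qed.

Lemma measurable_circle : lebesgue_measurable (circle R).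
Proof. by apply: borel_lebesgue_measurable; exact: measurable_itv. Qed.

Lemma Leb_circle : Leb R (circle R) = (2 * pi)%:E.
Proof.
have := @lebesgue_measure_itv R `[0, 2 * pi[.
rewrite /= lte_fin mulr_gt0 ?pi_gt0// oppr0 adde0 => <-; by [].
Qed.

Lemma Leb_circle_fin A : lebesgue_measurable A -> A `<=` circle R ->
  (Leb R A < +oo)%E.
Proof.
move=> mA sA; apply: (@le_lt_trans _ _ (Leb R (circle R))).
  by apply: le_measure => //; rewrite inE//; exact: measurable_circle.
by rewrite Leb_circle ltry.
Qed.

Lemma borel_measurable_fun A (f : R -> R) : lebesgue_measurable A ->
  measurable_fun (setT : set R) f ->
  measurable_fun (A : set (lebT R)) (f : lebT R -> R).
Proof.
move=> mA mf _ Y mY; apply: measurableI => //.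
apply: sub_caratheodory; rewrite -[X in _ X]setTI; exact: mf.
Qed.

Lemma continuous_lebesgue_measurable A (f : R -> R) : lebesgue_measurable A ->
  continuous f -> measurable_fun (A : set (lebT R)) (f : lebT R -> R).
Proof.
move=> mA cf; apply: borel_measurable_fun => //.
exact: continuous_measurable_fun.
Qed.

(** Filter rules for [{ae Leb R, _}], whose filter structure is not inferred. *)
Lemma ae_LebS (P Q : R -> Prop) : (forall t, P t -> Q t) ->
  {ae Leb R, forall t, P t} -> {ae Leb R, forall t, Q t}.
Proof.
by move=> PQ [N [mN N0 sub]]; exists N; split => // t nQ; apply: sub => /PQ.
Qed.

Lemma ae_LebS2 (P1 P2 Q : R -> Prop) : (forall t, P1 t -> P2 t -> Q t) ->
  {ae Leb R, forall t, P1 t} -> {ae Leb R, forall t, P2 t} ->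
  {ae Leb R, forall t, Q t}.
Proof.
move=> PQ [N [mN N0 sub]] [N' [mN' N0' sub']]; exists (N `|` N').
split; first exact: measurableU.
  by rewrite measureU0.
move=> t nQ; apply: contrapT => /not_orP[nN nN'].
apply: nQ; apply: PQ; apply: contrapT => ?; first exact/nN/sub.
exact/nN'/sub'.
Qed.

End circle_measure.

Section cmeasurable.
Variables (R : realType) (A : set R).
Hypothesis mA : lebesgue_measurable A.
Implicit Types u v : R -> R[i].

Lemma cmeasurableD u v : cmeasurable_fun A u -> cmeasurable_fun A v ->
  cmeasurable_fun A (fun t => u t + v t).
Proof.
move=> [u1 u2] [v1 v2]; split.
  by under eq_fun do rewrite ReD; exact: measurable_funD.
by under eq_fun do rewrite ImD; exact: measurable_funD.
Qed.

Lemma cmeasurableM u v : cmeasurable_fun A u -> cmeasurable_fun A v ->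
  cmeasurable_fun A (fun t => u t * v t).
Proof.
move=> [u1 u2] [v1 v2]; split.
  by under eq_fun do rewrite ReM; apply: measurable_funB; exact: measurable_funM.
by under eq_fun do rewrite ImM; apply: measurable_funD; exact: measurable_funM.
Qed.

Lemma cmeasurable_cst c : cmeasurable_fun A (fun=> c).
Proof. by split; exact: measurable_cst. Qed.

Lemma cmeasurableN u : cmeasurable_fun A u -> cmeasurable_fun A (fun t => - u t).
Proof.
move=> [u1 u2]; split.
  by under eq_fun do rewrite ReN; exact: measurable_funN.
by under eq_fun do rewrite ImN; exact: measurable_funN.
Qed.

Lemma cmeasurableB u v : cmeasurable_fun A u -> cmeasurable_fun A v ->
  cmeasurable_fun A (fun t => u t - v t).
Proof. by move=> mu mv; exact: (cmeasurableD mu (cmeasurableN mv)). Qed.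

Lemma cmeasurableJ u : cmeasurable_fun A u ->
  cmeasurable_fun A (fun t => conjc (u t)).
Proof.
move=> [u1 u2]; split; first by under eq_fun do rewrite ReJ.
by under eq_fun do rewrite ImJ; exact: measurable_funN.
Qed.

End cmeasurable.

Section L2_theory.
Variables (R : realType) (A : set R).
Hypotheses (mA : lebesgue_measurable A) (sA : A `<=` circle R).
Implicit Types u v : R -> R[i].

Let finA := Leb_circle_fin mA sA.
Local Notation sq := (@sqint _ (lebT R) R (Leb R) A).

Lemma L2P u : L2 A u <->
  sq (fun t => complex.Re (u t)) /\ sq (fun t => complex.Im (u t)).
Proof.
have E : (\int[Leb R]_(t in A) (normc (u t) ^+ 2)%:E =
    \int[Leb R]_(t in A) (complex.Re (u t) ^+ 2 + complex.Im (u t) ^+ 2)%:E)%E.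
  by apply: eq_integral => t _; rewrite normc_sq.
rewrite (sqint_pairP (Leb R) mA) -E; exact: iff_refl.
Qed.

Lemma measurable_normc_sq u : cmeasurable_fun A u ->
  measurable_fun (A : set (lebT R)) ((fun t => normc (u t) ^+ 2) : lebT R -> R).
Proof.
move=> [u1 u2]; under eq_fun do rewrite normc_sq.
by apply: measurable_funD; exact: measurable_funX.
Qed.

Lemma L2D u v : L2 A u -> L2 A v -> L2 A (fun t => u t + v t).
Proof.
move=> /L2P[u1 u2] /L2P[v1 v2]; apply/L2P; split.
  by under eq_fun do rewrite ReD; exact: sqintD.
by under eq_fun do rewrite ImD; exact: sqintD.
Qed.

Lemma L2_mul m u M : cmeasurable_fun A m ->
  (forall t, A t -> normc (m t) ^+ 2 <= M) ->
  L2 A u -> L2 A (fun t => m t * u t).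
Proof.
move=> mm mM Lu; have [mu iu] := Lu.
have mmu := cmeasurableM mm mu.
split; first exact: mmu.
have mn := measurable_normc_sq mu.
have mk : measurable_fun (A : set (lebT R))
    ((fun t => M * normc (u t) ^+ 2) : lebT R -> R).
  by apply: measurable_funM mn; exact: measurable_cst.
apply: (integral_le_lty mA (measurable_normc_sq mmu) mk).
  move=> t At; rewrite sqr_ge0/= normc_sqM; apply: ler_wpM2r (mM t At).
  exact: sqr_ge0.
have iu' : (Leb R).-integrable (A : set (lebT R)) (fun t => (normc (u t) ^+ 2)%:E).
  apply/integrableP; split; first exact/measurable_EFinP.
  by under eq_integral do rewrite gee0_abs ?lee_fin ?sqr_ge0//.
have := integrableZl mA M iu'; move=> /(integrable_lty mA).
by under eq_integral do rewrite -EFinM.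
Qed.

Lemma L2Z c u : L2 A u -> L2 A (fun t => c * u t).
Proof.
by apply: (@L2_mul _ _ (normc c ^+ 2)) => //; exact: cmeasurable_cst.
Qed.

Lemma L2N u : L2 A u -> L2 A (fun t => - u t).
Proof. by move=> /(L2Z (-1)); under eq_fun do rewrite mulN1r. Qed.

Lemma L2B u v : L2 A u -> L2 A v -> L2 A (fun t => u t - v t).
Proof. by move=> Lu Lv; exact: (L2D Lu (L2N Lv)). Qed.

Lemma L2J u : L2 A u -> L2 A (fun t => conjc (u t)).
Proof.
move=> /L2P[u1 u2]; apply/L2P; split; first by under eq_fun do rewrite ReJ.
by under eq_fun do rewrite ImJ -mulN1r; exact: sqintZ.
Qed.

Lemma L2_bounded u M : cmeasurable_fun A u ->
  (forall t, A t -> normc (u t) ^+ 2 <= M) -> L2 A u.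
Proof.
move=> mu uM; have L1 : L2 A (fun=> 1).
  by apply/L2P; split => /=; exact: sqint_cst.
have := L2_mul mu uM L1; by under eq_fun do rewrite mulr1.
Qed.

End L2_theory.

Lemma L2S (R : realType) (A B : set R) (u : R -> R[i]) :
  lebesgue_measurable A -> lebesgue_measurable B ->
  B `<=` A -> L2 A u -> L2 B u.
Proof.
move=> mA mB BA /(L2P mA)[u1 u2]; apply/(L2P mB).
by split; [exact: (sqintS mA mB BA u1)|exact: (sqintS mA mB BA u2)].
Qed.

Section mean_theory.
Variables (R : realType) (A : set R).
Hypotheses (mA : lebesgue_measurable A).
Local Notation itg a := ((Leb R).-integrable (A : set (lebT R)) (EFin \o (a : lebT R -> R))).

Lemma pi2_gt0 : 0 < (2 * pi : R)^-1.
Proof. by rewrite invr_gt0 mulr_gt0// pi_gt0. Qed.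

Lemma meanD a b : itg a -> itg b -> mean A (fun t => a t + b t) = mean A a + mean A b.
Proof. by move=> ia ib; rewrite /mean RintegralD// mulrDr. Qed.

Lemma meanB a b : itg a -> itg b -> mean A (fun t => a t - b t) = mean A a - mean A b.
Proof. by move=> ia ib0; rewrite /mean RintegralB// mulrBr. Qed.

Lemma meanZ k a : itg a -> mean A (fun t => k * a t) = k * mean A a.
Proof. by move=> ia; rewrite /mean RintegralZl// mulrCA. Qed.

Lemma mean_ge0 a : (forall t, A t -> 0 <= a t) -> 0 <= mean A a.
Proof. by move=> a0; rewrite /mean mulr_ge0 ?(ltW pi2_gt0)//; exact: Rintegral_ge0. Qed.

Lemma eq_mean a b : (forall t, A t -> a t = b t) -> mean A a = mean A b.
Proof.
by move=> ab; congr (_ * _); apply: eq_Rintegral => t; rewrite inE => /ab.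
Qed.

End mean_theory.

(** The real part of the inner product of L^2(A). Real vector spaces suffice: the
    imaginary part is recovered by multiplying the second argument by i
    ([innerE]), and H^2 is stable under multiplication by i. The values are taken
    in [Rcomplex R], which carries the structure of real vector space. *)
Definition rform (R : realType) (A : set R) (u v : R -> Rcomplex R) : R :=
  mean A (fun t => complex.Re (u t) * complex.Re (v t)
                   + complex.Im (u t) * complex.Im (v t)).

Section rform_theory.
Variable R : realType.
Implicit Types (A B : set R) (u v w : R -> Rcomplex R).

Lemma L2_subspace A : lebesgue_measurable A -> A `<=` circle R ->
  lin_subspace (L2 A : set (R -> Rcomplex R)).
Proof.
move=> mA sA; split; first by apply/(L2P mA); split => /=;
  exact: (sqint_cst mA (Leb_circle_fin mA sA)).
move=> a u v Lu Lv; apply: (L2D mA); last exact: Lv.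
have -> : (a *: u) = (fun t => a%:C * u t).
  by apply/funext => t; apply: complex_eq; rewrite !ReImE /= mul0r ?subr0 ?addr0.
exact: (L2Z mA).
Qed.

Lemma rform_integrable A u v : lebesgue_measurable A -> A `<=` circle R ->
  L2 A u -> L2 A v ->
  (Leb R).-integrable (A : set (lebT R))
    (EFin \o (fun t => complex.Re (u t) * complex.Re (v t)
                   + complex.Im (u t) * complex.Im (v t))).
Proof.
move=> mA sA /(L2P mA)[u1 u2] /(L2P mA)[v1 v2].
by apply: eq_integrable (integrableD mA (sqint_mul mA u1 v1) (sqint_mul mA u2 v2)).
Qed.

Lemma rform_psd A : lebesgue_measurable A -> A `<=` circle R ->
  psd_form (L2 A : set (R -> Rcomplex R)) (rform A).
Proof.
move=> mA sA; split.
- exact: L2_subspace.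
- by move=> u v _ _; apply: eq_mean => t _; rewrite mulrC; congr (_ + _); rewrite mulrC.
- move=> a u v w Lu Lv Lw; rewrite /rform.
  rewrite -meanZ//; last exact: rform_integrable.
  rewrite -meanD//; last 2 first.
  + apply: eq_integrable (integrableZl mA a (rform_integrable mA sA Lu Lw)) => //.
  + exact: rform_integrable.
  by apply: eq_mean => t _; rewrite !ReImE; ring.
- by move=> u Lu; apply: mean_ge0 => t _; rewrite addr_ge0// -expr2 sqr_ge0.
Qed.

Lemma rform_psd_circle A : lebesgue_measurable A -> A `<=` circle R ->
  psd_form (L2 (circle R) : set (R -> Rcomplex R)) (rform A).
Proof.
move=> mA sA; have mC := @measurable_circle R.
apply: psd_formS (rform_psd mA sA); first exact: L2_subspace.
by move=> u; exact: (L2S mC mA sA).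
Qed.

Lemma rform_setU A B u v : lebesgue_measurable A -> lebesgue_measurable B ->
  A `|` B = circle R -> A `&` B = set0 -> L2 (circle R) u -> L2 (circle R) v ->
  rform (circle R) u v = rform A u v + rform B u v.
Proof.
move=> mA mB AB AB0 Lu Lv; have mC := @measurable_circle R.
rewrite /rform /mean -mulrDr -Rintegral_setU ?AB//; last exact/eqP.
exact: rform_integrable.
Qed.

Lemma rformxx A u : rform A u u = mean A (fun t => normc (u t) ^+ 2).
Proof. by apply: eq_mean => t _; rewrite normc_sq !expr2. Qed.

Lemma normL2_sq A u : normL2 A u ^+ 2 = rform A u u.
Proof.
by rewrite rformxx sqr_sqrtr// mean_ge0// => t _; exact: sqr_ge0.
Qed.

Lemma rform_complete : form_complete (L2 (circle R) : set (R -> Rcomplex R))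
  (rform (circle R)).
Proof.
move=> x C Lx xC; have mC := @measurable_circle R.
have fC := Leb_circle_fin mC (@subset_refl _ _).
have pp0 : 0 < 2 * pi :> R by rewrite mulr_gt0// pi_gt0.
have s1 n := ((L2P mC (x n)).1 (Lx n)).1.
have s2 n := ((L2P mC (x n)).1 (Lx n)).2.
have split_ u v (su : L2 (circle R) u) (sv : L2 (circle R) v) :
    rform (circle R) (u - v) (u - v) = (2 * pi)^-1 *
     (\int[Leb R]_(t in circle R) (complex.Re (u t) - complex.Re (v t)) ^+ 2
    + \int[Leb R]_(t in circle R) (complex.Im (u t) - complex.Im (v t)) ^+ 2).
  move: su sv => /(L2P mC)[u1 u2] /(L2P mC)[v1 v2].
  rewrite /rform /mean -RintegralD//; last 2 first.
  - by apply: sqint_sq_integrable; exact: sqintB.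
  - by apply: sqint_sq_integrable; exact: sqintB.
  by congr (_ * _); apply: eq_Rintegral => t _; rewrite !ReImE !expr2.
have pos (a : R -> R) : 0 <= \int[Leb R]_(t in circle R) a t ^+ 2.
  by apply: Rintegral_ge0 => t _; exact: sqr_ge0.
have h n : \int[Leb R]_(t in circle R) (complex.Re (x n.+1 t) - complex.Re (x n t)) ^+ 2
    + \int[Leb R]_(t in circle R) (complex.Im (x n.+1 t) - complex.Im (x n t)) ^+ 2
    <= (2 * pi * C) * 4 ^- n.
  have := xC n; rewrite (split_ _ _ (Lx _) (Lx _)) -(ler_pM2l pp0) mulrA mulfV.
    by rewrite mul1r mulrA.
  by rewrite gt_eqF.
have [|l1 sl1 h1] := @sqint_complete _ _ _ _ _ mC fC _ (2 * pi * C) s1.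
  move=> n; apply: le_trans (h n); rewrite lerDl; exact: pos.
have [|l2 sl2 h2] := @sqint_complete _ _ _ _ _ mC fC _ (2 * pi * C) s2.
  move=> n; apply: le_trans (h n); rewrite lerDr; exact: pos.
pose l : R -> Rcomplex R := fun t => Complex (l1 t) (l2 t).
have Ll : L2 (circle R) l by apply/(L2P mC); split; [exact: sl1|exact: sl2].
exists l => // e e0.
have C0 : 0 <= C.
  have := xC 0; rewrite expr0 invr1 mulr1; apply: le_trans.
  by apply: mean_ge0 => t _; rewrite addr_ge0// -expr2 sqr_ge0.
have : (fun n => (8 * C + 1) * (4^-1 : R) ^+ n) @ \oo --> (8 * C + 1) * 0.
  apply: cvgMr; apply: cvg_expr.
  by rewrite ger0_norm ?invr_ge0// invf_lt1// ltr1n.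
rewrite mulr0 => /cvgrPdist_le /(_ _ e0) [n0 _ H].
exists n0 => n /H /=; rewrite sub0r normrN => hn.
apply: le_trans (le_trans (ler_norm _) hn).
rewrite (split_ _ _ (Lx _) Ll) /= -(ler_pM2l pp0) mulrA mulfV ?mul1r; last first.
  by rewrite gt_eqF.
have := h1 n; have := h2 n; rewrite exprVn.
set c := 4 ^- n; have c0 : 0 <= c by rewrite invr_ge0 exprn_ge0.
have pc : 0 <= pi * c :> R by rewrite mulr_ge0// pi_ge0.
move=> h2n h1n; apply: (le_trans (lerD h1n h2n)).
(* the bounds for the real and imaginary parts add up *)
have -> : 4 * (2 * pi * C) * c + 4 * (2 * pi * C) * c = 2 * pi * (8 * C * c).
  by ring.
by rewrite ler_pM2l// [leRHS]mulrDl mul1r lerDl.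
Qed.

Lemma rform_eq0 A u : lebesgue_measurable A -> A `<=` circle R ->
  L2 A u -> rform A u u = 0 -> {ae Leb R, forall t, A t -> u t = 0}.
Proof.
move=> mA sA /(L2P mA)[s1 s2]; rewrite /rform /mean RintegralD//; last 2 first.
- exact: sqint_sq_integrable.
- exact: sqint_sq_integrable.
move=> /eqP; rewrite mulf_eq0 gt_eqF ?pi2_gt0//= paddr_eq0; last 2 first.
- by apply: Rintegral_ge0 => t _; rewrite -expr2 sqr_ge0.
- by apply: Rintegral_ge0 => t _; rewrite -expr2 sqr_ge0.
move=> /andP[/eqP z1 /eqP z2].
apply: ae_LebS2 (sq_int_eq0 mA s1 z1) (sq_int_eq0 mA s2 z2).
by move=> t h1 h2 At; apply: complex_eq; rewrite ?h1 ?h2.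
Qed.

Lemma ae_eq_mean A (a b : R -> R) : lebesgue_measurable A ->
  measurable_fun (A : set (lebT R)) (a : lebT R -> R) ->
  measurable_fun (A : set (lebT R)) (b : lebT R -> R) ->
  {ae Leb R, forall t, A t -> a t = b t} -> mean A a = mean A b.
Proof.
by move=> mA ma mb ab; congr (_ * _); exact: (ae_eq_Rintegral mA ma mb ab).
Qed.

Lemma innerE u v : inner u v =
  Complex (rform (circle R) u v) (rform (circle R) u (fun t => 'i * v t)).
Proof.
by congr Complex; apply: eq_mean => t _; rewrite !ReImE /=; ring.
Qed.

End rform_theory.

Lemma L2_vee (R : realType) (I J : set R) (u v : R -> R[i]) :
  lebesgue_measurable I -> lebesgue_measurable J -> I `|` J = circle R ->
  I `&` J = set0 -> L2 I u -> L2 J v -> L2 (circle R) (vee I u v).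
Proof.
move=> mI mJ IJ IJ0 [[u1 u2] iu] [[v1 v2] iv].
have nI t : J t -> t \in I = false.
  by move=> Jt; apply/negP; rewrite inE => It; have : (I `&` J) t by []; rewrite IJ0.
have uI t : I t -> vee I u v t = u t by move=> It; rewrite /vee mem_set.
have vJ t : J t -> vee I u v t = v t by move=> Jt; rewrite /vee nI.
have mvee : cmeasurable_fun (I `|` J) (vee I u v).
  split; apply/(measurable_funU _ mI mJ); split.
  - by apply: eq_measurable_fun u1 => t; rewrite inE => /uI ->.
  - by apply: eq_measurable_fun v1 => t; rewrite inE => /vJ ->.
  - by apply: eq_measurable_fun u2 => t; rewrite inE => /uI ->.
  - by apply: eq_measurable_fun v2 => t; rewrite inE => /vJ ->.
rewrite -IJ; split; first exact: mvee.
rewrite (ge0_integral_setU _ mI mJ).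
- rewrite lte_add_pinfty//.
    by move: iu; congr (_ < _)%E; apply: eq_integral => t; rewrite inE => /uI ->.
  by move: iv; congr (_ < _)%E; apply: eq_integral => t; rewrite inE => /vJ ->.
- by apply/measurable_EFinP; exact: (measurable_normc_sq mvee).
- by move=> t _; rewrite lee_fin sqr_ge0.
- exact/eqP.
Qed.

(** * Fourier series: uniqueness *)
Lemma continuous_cos_int (R : realType) (n : int) :
  continuous (fun t : R => cos (n%:~R * t)).
Proof.
move=> t; have : continuous (@cos R \o *%R n%:~R).
  by move=> s; apply: continuous_comp; [exact: mulrl_continuous|exact: continuous_cos].
by apply.
Qed.

Lemma continuous_sin_int (R : realType) (n : int) :
  continuous (fun t : R => sin (n%:~R * t)).
Proof.
move=> t; have : continuous (@sin R \o *%R n%:~R).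
  by move=> s; apply: continuous_comp; [exact: mulrl_continuous|exact: continuous_sin].
by apply.
Qed.

Section trig_limits.
Variable R : realType.
Local Notation mC := (@measurable_circle R).
Local Notation Lmeas f :=
  (measurable_fun (circle R : set (lebT R)) (f : lebT R -> R)).

(** The closure of the trigonometric polynomials under limits of bounded sequences
    that converge almost everywhere on the circle. As an inductive predicate it
    supports the only argument that is needed: a property of the generators that
    is stable under linear combinations and bounded limits holds throughout. *)
Inductive trig_limit : (R -> R) -> Prop :=
| trig_limit_cos (n : int) : trig_limit (fun t => cos (n%:~R * t))
| trig_limit_sin (n : int) : trig_limit (fun t => sin (n%:~R * t))
| trig_limit_lin (a : R) f g : trig_limit f -> trig_limit g ->
    trig_limit (fun t => a * f t + g t)
| trig_limit_lim (f_ : nat -> R -> R) f M : (forall n, trig_limit (f_ n)) ->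
    (forall n t, circle R t -> `|f_ n t| <= M) -> Lmeas f ->
    {ae Leb R, forall t, circle R t -> (fun n => f_ n t) @ \oo --> f t} ->
    (forall t, circle R t -> `|f t| <= M) -> trig_limit f.

Lemma trig_limit_bounded f : trig_limit f ->
  exists M, forall t, circle R t -> `|f t| <= M.
Proof.
elim=> {f} [n|n|a f g _ [M HM] _ [N HN]|f_ f M _ _ _ _ _ fM].
- by exists 1 => t _; exact: cos_max.
- by exists 1 => t _; exact: sin_max.
- exists (`|a| * M + N) => t Ct; apply: (le_trans (ler_normD _ _)).
  by rewrite lerD ?HN// normrM ler_wpM2l ?HM.
- by exists M.
Qed.

Lemma trig_limit_measurable f : trig_limit f -> Lmeas f.
Proof.
elim=> {f} [n|n|a f g _ mf _ mg|f_ f M _ _ _ mf _ _].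
- by apply: continuous_lebesgue_measurable; [exact: mC|exact: continuous_cos_int].
- by apply: continuous_lebesgue_measurable; [exact: mC|exact: continuous_sin_int].
- exact: (measurable_funD (measurable_funM (measurable_cst a) mf) mg).
- exact: mf.
Qed.

Lemma trig_limit1 : trig_limit (fun=> 1).
Proof.
have := trig_limit_cos 0; congr trig_limit; apply/funext => t.
by rewrite mul0r cos0.
Qed.

Lemma trig_limit0 : trig_limit (fun=> 0).
Proof.
have := trig_limit_sin 0; congr trig_limit; apply/funext => t.
by rewrite mul0r sin0.
Qed.

Lemma trig_limitZ a f : trig_limit f -> trig_limit (fun t => a * f t).
Proof.
move=> tf; have := trig_limit_lin a tf trig_limit0; congr trig_limit.
by apply/funext => t; rewrite addr0.
Qed.

Lemma trig_limitD f g : trig_limit f -> trig_limit g ->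
  trig_limit (fun t => f t + g t).
Proof.
move=> tf tg; have := trig_limit_lin 1 tf tg; congr trig_limit.
by apply/funext => t; rewrite mul1r.
Qed.

Lemma trig_limitB f g : trig_limit f -> trig_limit g ->
  trig_limit (fun t => f t - g t).
Proof.
move=> tf tg; have := trig_limit_lin (-1) tg tf; congr trig_limit.
by apply/funext => t; rewrite mulN1r addrC.
Qed.

(* multiplication by a bounded function preserves bounded convergence *)
Let limM (f_ : nat -> R -> R) f g M : trig_limit g ->
  (forall n, trig_limit (fun t => f_ n t * g t)) ->
  (forall n t, circle R t -> `|f_ n t| <= M) -> Lmeas f ->
  {ae Leb R, forall t, circle R t -> (fun n => f_ n t) @ \oo --> f t} ->
  (forall t, circle R t -> `|f t| <= M) -> trig_limit (fun t => f t * g t).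
Proof.
move=> tg tfg fM mf cf fM'; have [N gN] := trig_limit_bounded tg.
apply: (@trig_limit_lim (fun n t => f_ n t * g t) _ (M * N)).
- exact: tfg.
- by move=> n t Ct; rewrite normrM ler_pM// ?fM// gN.
- exact: (measurable_funM mf (trig_limit_measurable tg)).
- by apply: ae_LebS cf => t ct Ct; apply: cvgM; [exact: ct|exact: cvg_cst].
- by move=> t Ct; rewrite normrM ler_pM// ?fM'// gN.
Qed.

Let prod_cos (n : int) g : trig_limit g ->
  trig_limit (fun t => cos (n%:~R * t) * g t) /\
  trig_limit (fun t => sin (n%:~R * t) * g t).
Proof.
have half f : trig_limit (fun t => 2 * f t) -> trig_limit f.
  move=> /(trig_limitZ 2^-1); congr trig_limit; apply/funext => t.
  by rewrite mulrA mulVf ?mul1r.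
elim=> {g} [m|m|a f g _ [IHc IHs] _ [JHc JHs]|f_ f M tf IH fM mf cf fM'].
- split; apply: half.
  + have := trig_limitD (trig_limit_cos (n + m)) (trig_limit_cos (n - m)).
    congr trig_limit; apply/funext => t.
    by rewrite intrD intrB mulrDl mulrBl cosD cosB; ring.
  + have := trig_limitD (trig_limit_sin (n + m)) (trig_limit_sin (n - m)).
    congr trig_limit; apply/funext => t.
    by rewrite intrD intrB mulrDl mulrBl sinD sinB; ring.
- split; apply: half.
  + have := trig_limitB (trig_limit_sin (n + m)) (trig_limit_sin (n - m)).
    congr trig_limit; apply/funext => t.
    by rewrite intrD intrB mulrDl mulrBl sinD sinB; ring.
  + have := trig_limitB (trig_limit_cos (n - m)) (trig_limit_cos (n + m)).
    congr trig_limit; apply/funext => t.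
    by rewrite intrB intrD mulrBl mulrDl cosB cosD; ring.
- split; [have := trig_limit_lin a IHc JHc|have := trig_limit_lin a IHs JHs];
    by congr trig_limit; apply/funext => t; ring.
- split; [have c := trig_limit_cos n|have c := trig_limit_sin n];
    under eq_fun do rewrite mulrC; apply: (limM c _ fM mf cf fM') => k;
    under eq_fun do rewrite mulrC; by case: (IH k).
Qed.

(** For generators the product formulas of trigonometry apply; the general case
    follows by induction on one factor, then on the other. *)
Lemma trig_limitM f g : trig_limit f -> trig_limit g ->
  trig_limit (fun t => f t * g t).
Proof.
move=> tf tg; elim: tf => {f} [n|n|a f h _ IHf _ IHg|f_ f M tf IH fM mf cf fM'].
- by case: (prod_cos n tg).
- by case: (prod_cos n tg).
- have := trig_limit_lin a IHf IHg; congr trig_limit.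
  by apply/funext => t; ring.
- exact: (limM tg IH fM mf cf fM').
Qed.

(** Changing a function on a null set is a limit of a constant sequence. *)
Lemma eq_trig_limit f g : trig_limit f -> Lmeas g ->
  {ae Leb R, forall t, circle R t -> f t = g t} ->
  (exists M, forall t, circle R t -> `|g t| <= M) -> trig_limit g.
Proof.
move=> tf mg fg [N gN]; have [M fM] := trig_limit_bounded tf.
apply: (@trig_limit_lim (fun=> f) _ (M + N)).
- by [].
- move=> _ t Ct; apply: (le_trans (fM t Ct)); rewrite lerDl.
  exact: le_trans (gN t Ct).
- exact: mg.
- by apply: ae_LebS fg => t e Ct; rewrite -e//; exact: cvg_cst.
- move=> t Ct; apply: (le_trans (gN t Ct)); rewrite lerDr.
  exact: le_trans (fM t Ct).
Qed.

(** This polynomial maps [-1, 1] to itself, is odd, and its iterates increase to 1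
    on ]0, 1]: they converge to the sign function. *)
Let step (y : R) := (3 * y - y ^+ 3) / 2.

Let step01 y : 0 <= y <= 1 -> y <= step y <= 1.
Proof.
move=> /andP[y0 y1]; apply/andP; split.
  have -> : step y = y + y * (1 - y) * (1 + y) / 2 by rewrite /step; field.
  by rewrite lerDl divr_ge0// !mulr_ge0//; lra.
have -> : step y = 1 - (1 - y) ^+ 2 * (2 + y) / 2 by rewrite /step; field.
by rewrite lerBlDr lerDl divr_ge0// mulr_ge0 ?sqr_ge0//; lra.
Qed.

Let iter_step01 n y : 0 <= y <= 1 -> y <= iter n step y <= 1.
Proof.
move=> y01; elim: n => [|n /andP[IH1 IH2]]; first by rewrite lexx; case/andP: y01.
have /step01/andP[h1 h2] : 0 <= iter n step y <= 1.
  by rewrite IH2 (le_trans _ IH1)//; case/andP: y01.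
by rewrite iterS h2 (le_trans IH1 h1).
Qed.

Let iter_stepN n y : iter n step (- y) = - iter n step y.
Proof. by elim: n => //= n ->; rewrite /step; field. Qed.

Let iter_step_cvg_pos y : 0 < y <= 1 -> (fun n => iter n step y) @ \oo --> (1 : R).
Proof.
move=> /andP[y0 y1]; have y01 : 0 <= y <= 1 by rewrite ltW.
have bnd n : 1 - (1 - y / 2) ^+ n <= iter n step y <= 1.
  elim: n => [|n /andP[IH1 _]]; first by rewrite expr0 subrr ltW.
  have /andP[h1 h2] := iter_step01 n y01.
  have /andP[_ ->] := iter_step01 n.+1 y01; rewrite andbT iterS.
  set z := iter n step y in IH1 h1 h2 *; set p := (1 - y / 2) ^+ n in IH1.
  (* one step multiplies 1 - z by at most 1 - y / 2, because z >= y *)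
  have -> : step z = 1 - (1 - z) * (1 - (z + z ^+ 2) / 2) by rewrite /step; field.
  rewrite lerD2l lerN2 [leRHS]exprSr -/p.
  apply: ler_pM; [lra|by have := sqr_ge0 (1 - z); nra|lra|].
  have := sqr_ge0 z; lra.
apply: (@squeeze_cvgr _ _ _ _ (fun n => 1 - (1 - y / 2) ^+ n) (fun=> 1)).
- by apply: nearW => n; exact: bnd.
- rewrite -[X in _ --> X]subr0; apply: cvgB; first exact: cvg_cst.
  by apply: cvg_expr; rewrite ger0_norm; lra.
- exact: cvg_cst.
Qed.

Let iter_step_cvg y : `|y| <= 1 -> (fun n => iter n step y) @ \oo --> Num.sg y.
Proof.
rewrite ler_norml => /andP[y1 y2]; case: (sgrP y) => y0.
- rewrite y0; have -> : (fun n => iter n step 0) = (fun=> 0).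
    by apply/funext => n; elim: n => //= n ->; rewrite /step; field.
  exact: cvg_cst.
- by apply: iter_step_cvg_pos; rewrite y0 y2.
- have -> : (fun n => iter n step y) = (fun n => - iter n step (- y)).
    by apply/funext => n; rewrite iter_stepN opprK.
  by apply: cvgN; apply: iter_step_cvg_pos; lra.
Qed.

Let iter_step_le1 n y : `|y| <= 1 -> `|iter n step y| <= 1.
Proof.
have pos z : 0 <= z <= 1 -> `|iter n step z| <= 1.
  move=> z01; have /andP[h1 h2] := iter_step01 n z01.
  by rewrite ger0_norm// (le_trans _ h1)//; case/andP: z01.
rewrite ler_norml => /andP[y1 y2]; have [y0|y0] := leP 0 y.
  by apply: pos; rewrite y0.
by rewrite -[y]opprK iter_stepN normrN; apply: pos; lra.
Qed.

(** After scaling [f] into [-1, 1], the sign is the limit of polynomials in [f]. *)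
Lemma trig_limit_sg f : trig_limit f -> trig_limit (fun t => Num.sg (f t)).
Proof.
move=> tf; have [M0 fM0] := trig_limit_bounded tf; pose M := `|M0| + 1.
have M0' : 0 < M by rewrite ltr_wpDl.
pose g t := M^-1 * f t.
have g1 t : circle R t -> `|g t| <= 1.
  move=> Ct; rewrite normrM gtr0_norm ?invr_gt0// mulrC ler_pdivrMr// mul1r.
  apply: (le_trans (fM0 t Ct)); rewrite /M; have := ler_norm M0; lra.
have tg : trig_limit g by exact: trig_limitZ.
have tit n : trig_limit (fun t => iter n step (g t)).
  elim: n => [|n IH]; first exact: tg.
  have := trig_limitB (trig_limitZ (3 / 2) IH)
    (trig_limitZ 2^-1 (trig_limitM IH (trig_limitM IH IH))).
  by congr trig_limit; apply/funext => t; rewrite iterS /step; field.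
have sgE t : Num.sg (f t) = Num.sg (g t).
  by rewrite /g sgrM (_ : Num.sg M^-1 = 1) ?mul1r// gtr0_sg ?invr_gt0.
have cg t : circle R t -> (fun n => iter n step (g t)) @ \oo --> Num.sg (f t).
  by move=> Ct; rewrite sgE; apply: iter_step_cvg; exact: g1.
apply: (@trig_limit_lim (fun n t => iter n step (g t)) _ 1).
- exact: tit.
- by move=> n t Ct; apply: iter_step_le1; exact: g1.
- apply: (measurable_fun_cvg (fun n => trig_limit_measurable (tit n))).
  exact: cg.
- by apply: aeW => t; exact: cg.
- by move=> t _; rewrite normr_sg; case: (_ != 0).
Qed.

End trig_limits.

Section trig_sets.
Variable R : realType.
Local Notation mC := (@measurable_circle R).
Local Notation Lmeas f :=
  (measurable_fun (circle R : set (lebT R)) (f : lebT R -> R)).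
Implicit Types (E F : set R) (f : R -> R).

(** The sets whose indicator is a limit of trigonometric polynomials form a sigma
    algebra: products give intersections, and limits give countable unions. It
    contains the sets where a member is positive, hence the Borel sets of the
    circle, and it is insensitive to null sets, hence contains all Lebesgue
    measurable sets. *)
Let trig_set E := trig_limit (\1_E : R -> R).

Let indic_le1 E t : `|\1_E t : R| <= 1.
Proof. by rewrite indicE; case: (_ \in _); rewrite ?normr1 ?normr0 ?ler01. Qed.

Let trig_setC E : trig_set E -> trig_set (~` E).
Proof.
move=> tE; have := trig_limitB (trig_limit1 R) tE; congr trig_limit.
by apply/funext => t; rewrite !indicE in_setC; case: (t \in E); rewrite ?subr0 ?subrr.
Qed.

Let trig_setI E F : trig_set E -> trig_set F -> trig_set (E `&` F).
Proof.
move=> tE tF; have := trig_limitM tE tF; congr trig_limit.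
by apply/funext => t; rewrite !indicE in_setI; case: (t \in E); case: (t \in F);
  rewrite ?mulr1 ?mulr0.
Qed.

Let trig_setU E F : trig_set E -> trig_set F -> trig_set (E `|` F).
Proof.
by move=> tE tF; rewrite -[E `|` F]setCK setCU;
  exact: (trig_setC (trig_setI (trig_setC tE) (trig_setC tF))).
Qed.

Let trig_set0 : trig_set set0.
Proof.
by have := trig_limit0 R; congr trig_limit; apply/funext => t; rewrite indicE in_set0.
Qed.

Let trig_set_bigcup (A : nat -> set R) : (forall n, trig_set (A n)) ->
  trig_set (\bigcup_k A k).
Proof.
move=> tA; pose B n := \big[setU/set0]_(i < n) A i.
have tB n : trig_set (B n).
  elim: n => [|n IH]; first by rewrite /B big_ord0; exact: trig_set0.
  by rewrite /B big_ord_recr; exact: trig_setU.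
have cB t : (fun n => \1_(B n) t : R) @ \oo --> (\1_(\bigcup_k A k) t : R).
  have [[k _ Akt]|nA] := pselect ((\bigcup_k A k) t).
    apply: (@cvg_trans _ ((fun=> 1) @ \oo)); last first.
      by rewrite indicE mem_set//; [exact: cvg_cst|exists k].
    apply: near_eq_cvg; near=> n.
    rewrite indicE mem_set// /B -bigcup_mkord; exists k => //=.
    by near: n; exact: nbhs_infty_gt.
  rewrite [X in _ --> X]indicE memNset//.
  rewrite (_ : (fun n => _) = (fun=> 0)); first exact: cvg_cst.
  apply/funext => n; rewrite indicE memNset// /B -bigcup_mkord => -[k _ Akt].
  by apply: nA; exists k.
apply: (@trig_limit_lim _ (fun n => \1_(B n)) _ 1).
- exact: tB.
- by move=> n t _; exact: indic_le1.
- apply: (measurable_fun_cvg (fun n => trig_limit_measurable (tB n))).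
  by move=> t _; exact: cB.
- by apply: aeW => t _; exact: cB.
- by move=> t _; exact: indic_le1.
Unshelve. all: by end_near. Qed.

Let trig_set_gt0 f : trig_limit f -> trig_set [set t | 0 < f t].
Proof.
move=> /trig_limit_sg tf.
have := trig_limitZ 2^-1 (trig_limitD (trig_limitM tf tf) tf).
congr trig_limit; apply/funext => t; rewrite indicE.
(* (s^2 + s) / 2 is the indicator of 1 among the values -1, 0, 1 of s *)
case: (sgrP (f t)) => f0.
- by rewrite memNset/= ?f0 ?ltxx// mulr0 addr0 mulr0.
- by rewrite mem_set//= mulr1 mulVf.
- by rewrite memNset/= ?mulrNN ?mulr1 ?addrN ?mulr0//; apply/negP; rewrite -leNgt ltW.
Qed.

Let trig_set_ge0 f : trig_limit f -> trig_set [set t | 0 <= f t].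
Proof.
move=> tf; rewrite (_ : [set t | _] = ~` [set t | 0 < - 1 * f t]).
  exact/trig_setC/trig_set_gt0/trig_limitZ.
by apply/seteqP; split => t /=; rewrite mulN1r oppr_gt0 leNgt => /negP.
Qed.

Let trig_set_eq E F : trig_set E -> lebesgue_measurable F ->
  (forall t, circle R t -> E t <-> F t) -> trig_set F.
Proof.
move=> tE mF EF; apply: (eq_trig_limit tE).
- exact: measurable_indic.
- apply: aeW => t Ct; rewrite !indicE; congr ((nat_of_bool _)%:R).
  by apply/idP/idP; rewrite !inE => /(EF t Ct).
- by exists 1 => t _; exact: indic_le1.
Qed.

Let trig_cos : trig_limit (@cos R).
Proof.
by have := trig_limit_cos R 1; congr trig_limit; apply/funext => t; rewrite mul1r.
Qed.

Let trig_sin : trig_limit (@sin R).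
Proof.
by have := trig_limit_sin R 1; congr trig_limit; apply/funext => t; rewrite mul1r.
Qed.

Let trig_cst (c : R) : trig_limit (fun=> c).
Proof.
by have := trig_limitZ c (trig_limit1 R); congr trig_limit; apply/funext => t; rewrite mulr1.
Qed.

Let sin_lt0_circle t : pi < t < 2 * pi -> sin t < 0 :> R.
Proof.
move=> /andP[t1 t2]; rewrite -[t](subrK pi) sinDpi oppr_lt0.
by apply: sin_gt0_pi; lra.
Qed.

Let cos_circle (t : R) : cos t = cos (2 * pi - t).
Proof.
by rewrite -cosN -(cosD2pi (- t)) addrC -[pi *+ 2]mulr_natl.
Qed.

(** On the upper half circle, that is for sin t >= 0, the condition t <= a is a
    condition on cos t because cos decreases on [0, pi]; on the lower half one
    uses cos t = cos (2 pi - t). *)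
Let trig_set_ray a : trig_set [set t | t <= a].
Proof.
have mr : lebesgue_measurable [set t | t <= a].
  apply: borel_lebesgue_measurable.
  have -> : [set t | t <= a] = `]-oo, a]%classic by apply/seteqP; split => t.
  exact: measurable_itv.
have pi0 := pi_gt0 R.
have dec := @ltr_cos R.
have le_cos (x y : R) : 0 <= x <= pi -> 0 <= y <= pi -> (cos x <= cos y) = (y <= x).
  by move=> hx hy; rewrite !leNgt dec// in_itv.
have [a0|a0] := ltP a 0.
  apply: (trig_set_eq trig_set0 mr) => t; rewrite /circle/= in_itv/= => /andP[t0 _].
  by split=> //; rewrite leNgt (lt_le_trans a0 t0).
have [api|pia] := leP a pi.
  apply: (trig_set_eq (trig_setI (trig_set_ge0 trig_sin)
    (trig_set_ge0 (trig_limitB trig_cos (trig_cst (cos a))))) mr) => t.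
  rewrite /circle/= in_itv/= => /andP[t0 t2]; rewrite subr_ge0.
  have [tpi|tpi] := leP t pi.
    rewrite le_cos ?a0 ?api ?t0 ?tpi//.
    by split=> [[]//|ta]; split => //; apply: sin_ge0_pi; rewrite t0 tpi.
  split=> [[]|]; last by move=> ta; move: (le_lt_trans ta (le_lt_trans api tpi)); rewrite ltxx.
  by rewrite leNgt sin_lt0_circle// tpi.
have [a2|a2] := leP (2 * pi) a.
  apply: (trig_set_eq (trig_setC trig_set0) mr) => t.
  by rewrite /circle/= in_itv/= => /andP[_ t2]; split=> [_|_ []]; exact: ltW (lt_le_trans t2 a2).
apply: (trig_set_eq (trig_setU (trig_set_ge0 trig_sin)
    (trig_set_ge0 (trig_limitB (trig_cst (cos a)) trig_cos))) mr) => t.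
rewrite /circle/= in_itv/= => /andP[t0 t2]; rewrite subr_ge0.
have [tpi|tpi] := leP t pi.
  split=> _; first exact: le_trans (ltW pia).
  by left; apply: sin_ge0_pi; rewrite t0.
rewrite (cos_circle t) (cos_circle a) le_cos; [|lra|lra].
split=> [[|]|ta]; last by right; lra.
  by rewrite leNgt sin_lt0_circle// tpi.
by lra.
Qed.

Let trig_set_borel E : measurable (E : set (measurableTypeR R)) -> trig_set E.
Proof.
apply: smallest_sub; first split => /=.
- exact: trig_set0.
- by move=> A tA; rewrite setTD; exact: trig_setC.
- exact: trig_set_bigcup.
move=> _ [[a b] _ <-] /=.
rewrite (_ : `]a, b]%classic = (~` [set t | t <= a]) `&` [set t | t <= b]).
  exact: trig_setI (trig_setC (trig_set_ray a)) (trig_set_ray b).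
apply/seteqP; split => t /=; rewrite in_itv/=.
  by move=> /andP[h ->]; split => //; apply/negP; rewrite -ltNge.
by move=> [/negP]; rewrite -ltNge => -> ->.
Qed.

Lemma trig_limit_indic E : lebesgue_measurable E -> trig_limit (\1_E : R -> R).
Proof.
move=> mE; have := mE; rewrite /lebesgue_measurable -completed_caratheodory_measurable.
rewrite g_sigma_completed_algebra_genE => -[A mA [N [M [mM M0 NM]] AN]].
apply: (eq_trig_limit (trig_set_borel mA)).
- exact: measurable_indic.
- exists M; split; [exact: sub_caratheodory|exact: M0|].
  move=> t /= H; apply: NM; apply: contrapT => nN; apply: H => Ct.
  rewrite !indicE; congr ((nat_of_bool _)%:R).
  by apply/idP/idP; rewrite !inE -AN; [left|case].
- by exists 1 => t _; exact: indic_le1.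
Qed.

End trig_sets.

Section fourier_uniqueness.
Variable R : realType.
Local Notation mC := (@measurable_circle R).
Variable w : R -> R.
Hypothesis iw : (Leb R).-integrable (circle R : set (lebT R)) (EFin \o (w : lebT R -> R)).

(** The orthogonality extends to all limits of trigonometric polynomials, among
    which is the sign of [w]. *)
Theorem fourier_uniqueness :
  (forall n : int, \int[Leb R]_(t in circle R) (cos (n%:~R * t) * w t) = 0) ->
  (forall n : int, \int[Leb R]_(t in circle R) (sin (n%:~R * t) * w t) = 0) ->
  {ae Leb R, forall t, circle R t -> w t = 0}.
Proof.
move=> w_cos w_sin; have mCR := mC.
have ifw f : trig_limit f ->
    (Leb R).-integrable (circle R : set (lebT R)) (fun t => (f t * w t)%:E).
  move=> tf; have [M fM] := trig_limit_bounded tf.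
  exact: (bounded_mul_integrable mCR iw (trig_limit_measurable tf) fM).
have fin f : trig_limit f -> \int[Leb R]_(t in circle R) (f t * w t) = 0 ->
    (\int[Leb R]_(t in circle R) (f t * w t)%:E = 0)%E.
  move=> tf h; rewrite -[LHS]fineK; first by rewrite [X in X%:E]h.
  exact: (integrable_fin_num mCR (ifw f tf)).
have main f : trig_limit f -> (\int[Leb R]_(t in circle R) (f t * w t)%:E = 0)%E.
  move=> tf; elim: tf => {f} [n|n|a f g tf IHf tg IHg|f_ f M tf IH fM mf cf fM'].
  - exact: (fin _ (trig_limit_cos R n) (w_cos n)).
  - exact: (fin _ (trig_limit_sin R n) (w_sin n)).
  - transitivity (\int[Leb R]_(t in circle R)
        (a%:E * (f t * w t)%:E + (g t * w t)%:E))%E.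
      by apply: eq_integral => t _; rewrite -EFinM -EFinD mulrDl mulrA.
    rewrite (integralD mCR (integrableZl mCR a (ifw f tf)) (ifw g tg)).
    by rewrite (integralZl mCR (ifw f tf)) IHf IHg mule0 add0e.
  - exact: (bounded_cvg_integral mCR iw (fun n => trig_limit_measurable (tf n)) fM mf cf IH).
have mw : measurable_fun (circle R : set (lebT R)) (w : lebT R -> R).
  by apply/measurable_EFinP; exact: measurable_int iw.
apply: (sg_integral_eq0 mCR iw); apply: main.
pose P := circle R `&` [set t | w t \in `]0, +oo[].
pose N := circle R `&` [set t | w t \in `]-oo, 0[].
have mP : lebesgue_measurable P := mw mCR _ (measurable_itv `]0, +oo[).
have mN : lebesgue_measurable N := mw mCR _ (measurable_itv `]-oo, 0[).
have tPN := trig_limitB (trig_limit_indic mP) (trig_limit_indic mN).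
have PNE t : circle R t -> (\1_P t - \1_N t : R) = Num.sg (w t).
  move=> Ct; have inP : (t \in P) = (0 < w t).
    apply/idP/idP; rewrite inE /P /= in_itv/= andbT; first by case.
    by move=> ->.
  have inN : (t \in N) = (w t < 0).
    apply/idP/idP; rewrite inE /N /= in_itv/=; first by case.
    by move=> ->.
  rewrite !indicE inP inN; case: (sgrP (w t)) => w0.
  - by rewrite subrr.
  - by rewrite subr0.
  - by rewrite sub0r.
apply: (eq_trig_limit tPN).
- apply: eq_measurable_fun (trig_limit_measurable tPN) => t; rewrite inE => Ct.
  exact: PNE.
- by apply: aeW => t; exact: PNE.
- by exists 1 => t _; rewrite normr_sg; case: (_ != 0).
Qed.

End fourier_uniqueness.

(** * Fourier coefficients and the Hardy space *)
Section trig_integrals.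
Variable R : realType.
Local Notation mC := (@measurable_circle R).

(** The fundamental theorem of calculus is about the Lebesgue measure on Borel
    sets, which is the image of its completion under the identity. *)
Lemma circle_integral_derive (f F : R -> R) (M : R) : continuous f ->
  (forall t, `|f t| <= M) -> (forall x : R, is_derive x 1 F (f x)) ->
  \int[Leb R]_(t in circle R) f t = F (2 * pi) - F 0.
Proof.
move=> cf fM dF; have p0 : 0 < 2 * pi :> R by rewrite mulr_gt0// pi_gt0.
have mf : measurable_fun (setT : set (measurableTypeR R)) (EFin \o f).
  by apply/measurable_EFinP; exact: continuous_measurable_fun.
have ft : measurable_fun (circle R : set (lebT R)) (f : lebT R -> R).
  exact: continuous_lebesgue_measurable mC cf.
have mid : measurable_fun (setT : set (lebT R)) (idfun : lebT R -> measurableTypeR R).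
  by move=> _ Y mY; rewrite setTI; exact: sub_caratheodory.
have fin := Leb_circle_fin mC (@subset_refl _ (circle R)).
have iw : (Leb R).-integrable (circle R : set (lebT R)) (EFin \o (f : lebT R -> R)).
  exact: (sqint_integrable mC fin (sqint_bounded mC fin ft (fun t _ => fM t))).
have mc : measurable (circle R : set (measurableTypeR R)).
  by have := @measurable_itv R `[0, 2 * pi[.
have := @integral_pushforward _ _ (lebT R) (measurableTypeR R) R idfun mid (Leb R)
  (circle R) (EFin \o f) mf iw mc.
rewrite [X in X = _](_ : _ = \int[lebesgue_measure]_(x in circle R) (f x)%:E)%E//.
rewrite /circle integral_itv_bndo_bndc; last exact: measurable_funS mf.
have cF : continuous F.
  by move=> x; apply/differentiable_continuous/derivable1_diffP; exact: (dF x).(ex_derive).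
rewrite (continuous_FTC2 p0 (F := F)).
- by rewrite /Rintegral => <-; rewrite -EFinB.
- exact: continuous_subspaceT.
- split; first by move=> x _; exact: (dF x).(ex_derive).
  + exact/cvg_at_right_filter/cF.
  + exact/cvg_at_left_filter/cF.
- by move=> x _; rewrite derive1E; exact: (dF x).(derive_val).
Qed.

Lemma sin_int2pi (k : int) : sin (k%:~R * (2 * pi)) = 0 :> R.
Proof.
have h (n : nat) : sin (n%:R * (2 * pi)) = 0 :> R.
  have := periodicn (@sinD2pi R) n 0; rewrite add0r sin0 => <-.
  by congr sin; rewrite mulr_natl -(mulr_natl pi).
case: k => n; first exact: h.
by rewrite NegzE intrN mulNr sinN h oppr0.
Qed.

Lemma cos_int2pi (k : int) : cos (k%:~R * (2 * pi)) = 1 :> R.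
Proof.
have h (n : nat) : cos (n%:R * (2 * pi)) = 1 :> R.
  rewrite mulr_natl (mulr_natl pi).
  by have := periodicn (@cosD2pi R) n 0; rewrite add0r cos0.
case: k => n; first exact: h.
by rewrite NegzE intrN mulNr cosN h.
Qed.

Lemma int_cos (k : int) : k != 0 ->
  \int[Leb R]_(t in circle R) cos (k%:~R * t) = 0.
Proof.
move=> k0; have k0R : k%:~R != 0 :> R by rewrite intr_eq0.
have dF (x : R) : is_derive x 1 (fun t => k%:~R^-1 * sin (k%:~R * t)) (cos (k%:~R * x)).
  have dm : is_derive x 1 ( *%R (k%:~R : R)) (k%:~R * 1) by exact: is_deriveZ.
  have ds := is_derive1_comp (is_derive_sin (k%:~R * x)) dm.
  have -> : cos (k%:~R * x) = k%:~R^-1 *: (cos (k%:~R * x) * (k%:~R * 1)).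
    by rewrite /GRing.scale/= mulr1 mulrCA mulVf ?mulr1.
  have dz := is_deriveZ k%:~R^-1 ds; refine dz.
rewrite (circle_integral_derive (@continuous_cos_int R k) (fun t => cos_max _) dF).
by rewrite sin_int2pi !mulr0 sin0 mulr0 subrr.
Qed.

Lemma int_sin (k : int) : \int[Leb R]_(t in circle R) sin (k%:~R * t) = 0.
Proof.
have [->|k0] := eqVneq k 0.
  under eq_Rintegral do rewrite mul0r sin0.
  by rewrite Rintegral_cst ?mul0r//; exact: mC.
have k0R : k%:~R != 0 :> R by rewrite intr_eq0.
have dF (x : R) : is_derive x 1 (fun t => - k%:~R^-1 * cos (k%:~R * t)) (sin (k%:~R * x)).
  have dm : is_derive x 1 ( *%R (k%:~R : R)) (k%:~R * 1) by exact: is_deriveZ.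
  have ds := is_derive1_comp (is_derive_cos (k%:~R * x)) dm.
  have -> : sin (k%:~R * x) = - k%:~R^-1 *: (- sin (k%:~R * x) * (k%:~R * 1)).
    by rewrite /GRing.scale/= mulr1 !mulNr mulrN opprK mulrCA mulVf ?mulr1.
  have dz := is_deriveZ (- k%:~R^-1) ds; refine dz.
rewrite (circle_integral_derive (@continuous_sin_int R k) (fun t => sin_max _) dF).
by rewrite cos_int2pi mulr0 cos0 subrr.
Qed.

End trig_integrals.

Section fourier_theory.
Variable R : realType.
Local Notation C := (circle R).
Local Notation mC := (@measurable_circle R).
Implicit Types (u v w : R -> Rcomplex R) (n m k : int).

Definition monom n : R -> Rcomplex R := fun t => expi (n%:~R * t).

Definition imonom n : R -> Rcomplex R := fun t => 'i * expi (n%:~R * t).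

Lemma expiD (x y : R) : expi (x + y) = expi x * expi y :> R[i].
Proof. by apply: complex_eq; rewrite ?ReImE /= ?cosD ?sinD//; ring. Qed.

Lemma normc_expi (x : R) : normc (expi x) ^+ 2 = 1.
Proof. by rewrite normc_sq /= cos2Dsin2. Qed.

Lemma conjc_expi (x : R) : conjc (expi x) = expi (- x).
Proof. by apply: complex_eq; rewrite ?ReImE /= ?cosN ?sinN. Qed.

Lemma L2_circle_subspace : lin_subspace (L2 C : set (R -> Rcomplex R)).
Proof. exact: L2_subspace mC (@subset_refl _ _). Qed.

Lemma cmeasurable_monom n : cmeasurable_fun C (monom n).
Proof.
split; [exact: continuous_lebesgue_measurable mC (@continuous_cos_int R n)|
        exact: continuous_lebesgue_measurable mC (@continuous_sin_int R n)].
Qed.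

Lemma L2_monom n : L2 C (monom n).
Proof.
apply: (L2_bounded mC (@subset_refl _ _) (cmeasurable_monom n) (M := 1)) => t _.
by rewrite normc_expi.
Qed.

Lemma L2_imonom n : L2 C (imonom n).
Proof. exact: (L2Z mC 'i (L2_monom n)). Qed.

Lemma fourierE u n :
  fourier u n = Complex (rform C u (monom n)) (rform C u (imonom n)).
Proof.
by congr Complex; apply: eq_mean => t _; rewrite !ReImE /= cosN sinN; ring.
Qed.

Lemma fourier_eq0 u n :
  fourier u n = 0 <-> rform C u (monom n) = 0 /\ rform C u (imonom n) = 0.
Proof. by rewrite fourierE; split=> [[-> ->]|[-> ->]]. Qed.

Lemma eq_cmean (A : set R) (u v : R -> R[i]) :
  (forall t, A t -> u t = v t) -> cmean A u = cmean A v.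
Proof. by move=> uv; congr Complex; apply: eq_mean => t At; rewrite uv. Qed.

Lemma fourier_shift u k n :
  fourier (fun t => expi (k%:~R * t) * u t) n = fourier u (n - k).
Proof.
apply: eq_cmean => t _; rewrite intrB mulrBl opprB expiD.
by rewrite mulrAC mulrC.
Qed.

Lemma L2_shift u k : L2 C u -> L2 C (fun t => expi (k%:~R * t) * u t).
Proof.
apply: (L2_mul mC (cmeasurable_monom k) (M := 1)) => t _; by rewrite normc_expi.
Qed.

Lemma fourier_monom m n : m != n -> fourier (monom m) n = 0.
Proof.
move=> mn; have mn0 : m - n != 0 by rewrite subr_eq0.
have E : fourier (monom m) n = cmean C (fun t => expi ((m - n)%:~R * t)).
  by apply: eq_cmean => t _; rewrite intrB mulrBl expiD.
by rewrite E /cmean /mean /= int_cos// int_sin mulr0.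
Qed.

Lemma fourier_conj_eq0 u n : L2 C u ->
  fourier u (- n) = 0 -> fourier (fun t => conjc (u t)) n = 0.
Proof.
move=> Lu /fourier_eq0[h1 h2]; apply/fourier_eq0; split.
  rewrite -[RHS]h1; apply: eq_mean => t _.
  by rewrite /monom /imonom !ReImE /= intrN (mulNr n%:~R) cosN sinN; ring.
rewrite -[RHS]oppr0 -[in RHS]h2 -mulN1r -meanZ; last 2 first.
- exact: mC.
- exact: (rform_integrable mC (@subset_refl _ _) Lu (L2_imonom (- n))).
apply: eq_mean => t _; by rewrite /monom /imonom !ReImE /= intrN (mulNr n%:~R) cosN sinN; ring.
Qed.

End fourier_theory.

Arguments monom : clear implicits.
Arguments imonom : clear implicits.

Section hardy.
Variable R : realType.
Local Notation C := (circle R).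
Local Notation mC := (@measurable_circle R).
Local Notation sC := (@subset_refl _ (circle R)).
Implicit Types (u v w : R -> Rcomplex R) (n m k : int) (A : set R).

Let finC := Leb_circle_fin mC sC.

Lemma rform_ae0 A u w : lebesgue_measurable A -> A `<=` C -> L2 A u -> L2 A w ->
  {ae Leb R, forall t, A t -> u t = 0} -> rform A u w = 0.
Proof.
move=> mA sA Lu Lw u0; rewrite /rform.
have mI := measurable_int _ (rform_integrable mA sA Lu Lw).
rewrite (@ae_eq_mean _ A _ (fun=> 0) mA).
- by rewrite /mean Rintegral_cst ?mul0r ?mulr0.
- exact/measurable_EFinP.
- exact: measurable_cst.
- by apply: ae_LebS u0 => t h /h ->; rewrite !mul0r addr0.
Qed.

Lemma rform_indic A u w : A `<=` C ->
  rform C u (fun t => (\1_A t)%:C * w t) = rform A u w.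
Proof.
move=> sA; rewrite /rform /mean; congr (_ * _).
rewrite -[in RHS](setIidr sA) Rintegral_mkcondr; apply: eq_Rintegral => t _.
rewrite patchE !ReImE /= indicE; case: ifPn => tA /=.
  by ring.
by rewrite !mul0r subr0 addr0 !mulr0 addr0.
Qed.

Lemma L2_indic A w : lebesgue_measurable A -> L2 C w ->
  L2 C (fun t => (\1_A t)%:C * w t).
Proof.
move=> mA; apply: (L2_mul mC (M := 1)); first split.
- exact: measurable_indic.
- exact: measurable_cst.
- by move=> t _; rewrite normc_sq /= expr0n addr0 indicE; case: (_ \in _);
    rewrite ?expr1n ?expr0n.
Qed.

Lemma cmeanZ A c (u : R -> R[i]) : lebesgue_measurable A -> A `<=` C -> L2 A u ->
  cmean A (fun t => c * u t) = c * cmean A u.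
Proof.
move=> mA sA /(L2P mA)[s1 s2]; have fA := Leb_circle_fin mA sA.
have i1 := sqint_integrable mA fA s1; have i2 := sqint_integrable mA fA s2.
have i1' r := sqint_integrable mA fA (sqintZ mA r s1).
have i2' r := sqint_integrable mA fA (sqintZ mA r s2).
apply: complex_eq; rewrite !ReImE /=.
  rewrite -mulNr -(meanZ mA _ i1) -(meanZ mA _ i2) -(meanD mA (i1' _) (i2' _)).
  by apply: eq_mean => t _; rewrite !ReImE mulNr.
rewrite -(meanZ mA _ i1) -(meanZ mA _ i2) -(meanD mA (i2' _) (i1' _)).
by apply: eq_mean => t _; rewrite !ReImE.
Qed.

Lemma fourierZ c u n : L2 C u ->
  fourier (fun t => c * u t) n = c * fourier u n.
Proof.
move=> Lu; rewrite /fourier -cmeanZ; [|exact: mC|exact: sC|].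
  by apply: eq_cmean => t _; rewrite mulrA.
have := L2_shift (- n) Lu; congr L2; apply/funext => t.
by rewrite mulrC intrN mulNr.
Qed.

Lemma hardyZ c u : hardy2 u -> hardy2 (fun t => c * u t).
Proof.
move=> [Lu u0]; split; first exact: (L2Z mC c Lu).
by move=> n n0; rewrite (fourierZ _ _ Lu) (u0 n n0) mulr0.
Qed.

Lemma hardy_shift u k : 0 <= k -> hardy2 u -> hardy2 (fun t => expi (k%:~R * t) * u t).
Proof.
move=> k0 [Lu u0]; split; first exact: L2_shift.
by move=> n n0; rewrite fourier_shift u0// ltrBlDr (lt_le_trans n0)// add0r.
Qed.

Lemma hardy_monom n : 0 <= n -> hardy2 (monom R n).
Proof.
move=> n0; split; first exact: L2_monom.
by move=> m m0; rewrite fourier_monom// gt_eqF// (lt_le_trans m0).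
Qed.

(** The equations of H^2: the real and imaginary parts of the Fourier coefficients
    of negative index. *)
Definition hardy_levels (v : R -> Rcomplex R) (c : R) : Prop :=
  c = 0 /\ exists2 n : int, n < 0 & v = monom R n \/ v = imonom R n.

Lemma hardy_levelsP u : hardy2 u <->
  level_set (L2 C : set (R -> Rcomplex R)) (rform C) hardy_levels u.
Proof.
split=> [[Lu u0]|[Lu h]]; split => //.
- move=> v c [-> [n n0 vE]]; have [h1 h2] := (fourier_eq0 u n).1 (u0 n n0).
  by case: vE => ->.
- move=> n n0; apply/fourier_eq0.
  by split; apply: h; split => //; exists n => //; [left|right].
Qed.

Lemma hardy_levels_L2 v c : hardy_levels v c -> L2 C v.
Proof. by move=> [_ [n _ [->|->]]]; [exact: L2_monom|exact: L2_imonom]. Qed.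

Lemma hardy_subspace : lin_subspace (@hardy2 R : set (R -> Rcomplex R)).
Proof.
have -> : (@hardy2 R : set (R -> Rcomplex R)) =
    level_set (L2 C : set (R -> Rcomplex R)) (rform C) hardy_levels.
  by apply/seteqP; split => u /hardy_levelsP.
apply: (level_set_subspace (rform_psd mC sC)); first exact: hardy_levels_L2.
by move=> v c [].
Qed.

Lemma hardy_closed :
  form_closed (L2 C : set (R -> Rcomplex R)) (rform C) (@hardy2 R : set (R -> Rcomplex R)).
Proof.
have -> : (@hardy2 R : set (R -> Rcomplex R)) =
    level_set (L2 C : set (R -> Rcomplex R)) (rform C) hardy_levels.
  by apply/seteqP; split => u /hardy_levelsP.
exact: (level_set_closed (rform_psd mC sC) hardy_levels_L2).
Qed.

Lemma hardy_L2 : (@hardy2 R : set (R -> Rcomplex R)) `<=` L2 C.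
Proof. by move=> u []. Qed.

Lemma mean_cst c : mean C (fun=> c) = c :> R.
Proof.
rewrite /mean Rintegral_cst; last exact: mC.
rewrite [X in c * X](congr1 fine (@Leb_circle R)) /= mulrCA mulVf ?mulr1// gt_eqF//.
by rewrite mulr_gt0// pi_gt0.
Qed.

Lemma mean_eq0 (a : R -> R) : mean C a = 0 -> \int[Leb R]_(t in C) a t = 0.
Proof. by move/eqP; rewrite mulf_eq0 gt_eqF ?pi2_gt0//= => /eqP. Qed.

Let fourier_uniq (a : R -> R) : @sqint _ (lebT R) R (Leb R) C a ->
  (forall n, mean C (fun t => cos (n%:~R * t) * a t) = 0) ->
  (forall n, mean C (fun t => sin (n%:~R * t) * a t) = 0) ->
  {ae Leb R, forall t, C t -> a t = 0}.
Proof.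
move=> sa h1 h2; apply: fourier_uniqueness.
- exact: (sqint_integrable mC finC sa).
- by move=> n; exact: mean_eq0.
- by move=> n; exact: mean_eq0.
Qed.

(** The real and the imaginary part of [u] are treated separately: adding and
    subtracting the coefficients of index n and -n isolates their cosine and sine
    coefficients. *)
Lemma fourier_inj u : L2 C u -> (forall n, fourier u n = 0) ->
  {ae Leb R, forall t, C t -> u t = 0}.
Proof.
move=> Lu u0; have [s1 s2] := (L2P mC u).1 Lu.
have ic (a : R -> R) : @sqint _ (lebT R) R (Leb R) C a -> forall n,
    (Leb R).-integrable (C : set (lebT R)) (EFin \o (fun t => cos (n%:~R * t) * a t)).
  move=> sa n; have ia := sqint_integrable mC finC sa.
  exact: (bounded_mul_integrable mC ia
    (continuous_lebesgue_measurable mC (@continuous_cos_int R n)) (fun t _ => cos_max _)).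
have is_ (a : R -> R) : @sqint _ (lebT R) R (Leb R) C a -> forall n,
    (Leb R).-integrable (C : set (lebT R)) (EFin \o (fun t => sin (n%:~R * t) * a t)).
  move=> sa n; have ia := sqint_integrable mC finC sa.
  exact: (bounded_mul_integrable mC ia
    (continuous_lebesgue_measurable mC (@continuous_sin_int R n)) (fun t _ => sin_max _)).
pose rc n := mean C (fun t => cos (n%:~R * t) * complex.Re (u t)).
pose rs n := mean C (fun t => sin (n%:~R * t) * complex.Re (u t)).
pose jc n := mean C (fun t => cos (n%:~R * t) * complex.Im (u t)).
pose js n := mean C (fun t => sin (n%:~R * t) * complex.Im (u t)).
have e1 n : rc n + js n = 0.
  have [<- _] := (fourier_eq0 u n).1 (u0 n).
  rewrite /rc /js -(meanD mC (ic _ s1 n) (is_ _ s2 n)).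
  by apply: eq_mean => t _; rewrite /monom /=; ring.
have e2 n : jc n - rs n = 0.
  have [_ <-] := (fourier_eq0 u n).1 (u0 n).
  rewrite /rs /jc -(meanB mC (ic _ s2 n) (is_ _ s1 n)).
  by apply: eq_mean => t _; rewrite /imonom !ReImE /=; ring.
have cN (a : R -> R) n : mean C (fun t => cos ((- n)%:~R * t) * a t) =
    mean C (fun t => cos (n%:~R * t) * a t).
  by apply: eq_mean => t _; rewrite intrN (mulNr n%:~R) cosN.
have sN (a : R -> R) (sa : @sqint _ (lebT R) R (Leb R) C a) n :
    mean C (fun t => sin ((- n)%:~R * t) * a t) =
    - mean C (fun t => sin (n%:~R * t) * a t).
  rewrite -[RHS]mulN1r -(meanZ mC _ (is_ _ sa n)).
  by apply: eq_mean => t _; rewrite intrN (mulNr n%:~R) sinN mulN1r mulNr.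
have e1' n : rc n - js n = 0 by have := e1 (- n); rewrite /rc /js cN sN.
have e2' n : jc n + rs n = 0.
  by have := e2 (- n); rewrite /jc /rs cN sN// opprK.
have uR : {ae Leb R, forall t, C t -> complex.Re (u t) = 0}.
  apply: (fourier_uniq s1) => n.
    by have := e1 n; have := e1' n; rewrite -/(rc n); lra.
  by have := e2 n; have := e2' n; rewrite -/(rs n); lra.
have uI : {ae Leb R, forall t, C t -> complex.Im (u t) = 0}.
  apply: (fourier_uniq s2) => n.
    by have := e2 n; have := e2' n; rewrite -/(jc n); lra.
  by have := e1 n; have := e1' n; rewrite -/(js n); lra.
by apply: ae_LebS2 uR uI => t h1 h2 Ct; apply: complex_eq; [exact: h1|exact: h2].
Qed.

(** * Functions of the Hardy space that vanish on a set of positive measure *)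
Section uniqueness.
Variable J : set R.
Hypotheses (mJ : lebesgue_measurable J) (sJ : J `<=` C) (J0 : (0 < Leb R J)%E).

(** The equations of the set [K] below; vanishing on [J] is orthogonality to all
    products of the indicator of [J] with square integrable functions. *)
Let levels (v : R -> Rcomplex R) (c : R) : Prop :=
  [\/ hardy_levels v c,
      c = 0 /\ exists2 w, L2 C w & v = (fun t => (\1_J t)%:C * w t) |
      (v = monom R 0 /\ c = 1) \/ (v = imonom R 0 /\ c = 0)].

Let levels_L2 v c : levels v c -> L2 C v.
Proof.
move=> [/hardy_levels_L2//|[_ [w Lw ->]]|[[-> _]|[-> _]]].
- exact: L2_indic.
- exact: L2_monom.
- exact: L2_imonom.
Qed.

Let K : set (R -> Rcomplex R) := [set u | [/\ hardy2 u,
  {ae Leb R, forall t, J t -> u t = 0} & fourier u 0 = 1]].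

Let KE : K = level_set (L2 C : set (R -> Rcomplex R)) (rform C) levels.
Proof.
apply/seteqP; split => u.
- move=> [Hu uJ u1]; have Lu := hardy_L2 Hu; split => // v c [Hv|[-> [w Lw ->]]|].
  + exact: ((hardy_levelsP u).1 Hu).2.
  + rewrite (rform_indic _ _ sJ).
    exact: (rform_ae0 mJ sJ (L2S mC mJ sJ Lu) (L2S mC mJ sJ Lw) uJ).
  + by move: u1; rewrite fourierE => -[h1 h2] [[-> ->]|[-> ->]].
- move=> [Lu h]; split.
  + apply/hardy_levelsP; split => // v c vc; apply: h; exact: Or31.
  + have LuJ : L2 J u by exact: L2S mC mJ sJ Lu.
    apply: (rform_eq0 mJ sJ LuJ); rewrite -(rform_indic _ _ sJ).
    by apply: h; apply: Or32; split => //; exists u.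
  + rewrite fourierE; congr Complex; apply: h; apply: Or33; [left|right]; by [].
Qed.

Let K_direction theta v t : K theta -> hardy2 v ->
  {ae Leb R, forall s, J s -> v s = 0} -> fourier v 0 = 0 -> K (t *: v + theta).
Proof.
move=> [Ht tJ t1] Hv vJ v0; split.
- exact: hardy_subspace.2.
- apply: ae_LebS2 tJ vJ => s h1 h2 Js.
  by rewrite [LHS](_ : _ = t *: v s + theta s)// h1// h2// scaler0 addr0.
- have := t1; have [h1 h2] := (fourier_eq0 v 0).1 v0.
  have Lv := hardy_L2 Hv; have Lt := hardy_L2 Ht.
  rewrite !fourierE (psd_lin (rform_psd mC sC) t Lv Lt (L2_monom R 0)).
  rewrite (psd_lin (rform_psd mC sC) t Lv Lt (L2_imonom R 0)) h1 h2.
  by rewrite !mulr0 !add0r.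
Qed.

(** An element of least norm of [K] would have constant modulus, by orthogonality
    to its products with z^n, n >= 1, and by [fourier_uniqueness]; this constant
    is 0 because of [J]. *)
Let K_empty u : ~ K u.
Proof.
move=> Ku; have psdC := rform_psd mC sC.
have L0 : L2 C (0 : R -> Rcomplex R) := (L2_circle_subspace R).1.
have [|||theta Kt tmin] := proj_exists psdC (@rform_complete R) (K := K) _ _ _ Ku L0.
- by move=> v [/hardy_L2].
- by rewrite KE => x y; exact: (level_set_half psdC levels_L2).
- by rewrite KE; exact: (level_set_closed psdC levels_L2).
have [Ht tJ t1] := Kt; have Lt := hardy_L2 Ht.
(* first order condition in the directions that keep theta in K *)
have orth v : hardy2 v -> {ae Leb R, forall s, J s -> v s = 0} ->
    fourier v 0 = 0 -> rform C theta v = 0.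
  move=> Hv vJ v0; rewrite -[theta]subr0.
  apply: (minimizer_orth psdC Kt Lt L0 (hardy_L2 Hv) tmin) => t.
  exact: K_direction.
pose p t := normc (theta t) ^+ 2.
have ip : (Leb R).-integrable (C : set (lebT R)) (EFin \o (p : lebT R -> R)).
  have := rform_integrable mC sC Lt Lt; congr integrable.
  by apply/funext => t; rewrite /= /p normc_sq !expr2.
pose c := mean C p.
have shift0 n : 0 < n -> mean C (fun t => cos (n%:~R * t) * p t) = 0 /\
    mean C (fun t => sin (n%:~R * t) * p t) = 0.
  move=> n0; have Hv := hardy_shift (ltW n0) Ht.
  have vJ : {ae Leb R, forall s, J s -> expi (n%:~R * s) * theta s = 0}.
    by apply: ae_LebS tJ => s h /h ->; rewrite mulr0.
  have v0 : fourier (fun t => expi (n%:~R * t) * theta t) 0 = 0.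
    by rewrite fourier_shift; apply: Ht.2; rewrite sub0r oppr_lt0.
  split.
    rewrite -[RHS](orth _ Hv vJ v0); apply: eq_mean => t _.
    by rewrite /p normc_sq !ReImE /=; ring.
  (* the factor -i turns the real part of z^n |theta|^2 into its imaginary part *)
  have Hv' := hardyZ (- 'i) Hv.
  rewrite -[RHS](orth _ Hv'); first last.
  - by rewrite (fourierZ _ _ (hardy_L2 Hv)) v0 mulr0.
  - by apply: ae_LebS vJ => s h /h ->; rewrite mulr0.
  apply: eq_mean => t _; by rewrite /p normc_sq !ReImE /=; ring.
have icp n : (Leb R).-integrable (C : set (lebT R)) (EFin \o (fun t => cos (n%:~R * t) * p t)).
  exact: (bounded_mul_integrable mC ip
    (continuous_lebesgue_measurable mC (@continuous_cos_int R n)) (fun t _ => cos_max _)).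
have isp n : (Leb R).-integrable (C : set (lebT R)) (EFin \o (fun t => sin (n%:~R * t) * p t)).
  exact: (bounded_mul_integrable mC ip
    (continuous_lebesgue_measurable mC (@continuous_sin_int R n)) (fun t _ => sin_max _)).
have ic1 n : (Leb R).-integrable (C : set (lebT R)) (EFin \o (fun t => cos (n%:~R * t))).
  exact: (sqint_integrable mC finC ((L2P mC _).1 (L2_monom R n)).1).
have is1 n : (Leb R).-integrable (C : set (lebT R)) (EFin \o (fun t => sin (n%:~R * t))).
  exact: (sqint_integrable mC finC ((L2P mC _).1 (L2_monom R n)).2).
have ick n := integrableZl mC c (ic1 n); have isk n := integrableZl mC c (is1 n).
have mcp n : n != 0 -> mean C (fun t => cos (n%:~R * t) * p t) = 0.
  case: (ltrgtP n 0) => // n0 _; last exact: (shift0 n n0).1.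
  have n0' : 0 < - n by rewrite oppr_gt0.
  rewrite -[RHS](shift0 _ n0').1; apply: eq_mean => t _.
  by rewrite intrN (mulNr n%:~R) cosN.
have msp n : mean C (fun t => sin (n%:~R * t) * p t) = 0.
  case: (ltrgtP n 0) => n0; last first.
  - rewrite n0 (@eq_mean _ _ _ (fun=> 0)) ?mean_cst// => t _.
    by rewrite mul0r sin0 mul0r.
  - exact: (shift0 n n0).2.
  have n0' : 0 < - n by rewrite oppr_gt0.
  rewrite -[RHS](mulr0 (-1)) -[in RHS](shift0 _ n0').2 -(meanZ mC _ (isp _)).
  by apply: eq_mean => t _; rewrite intrN (mulNr n%:~R) sinN mulN1r mulNr opprK.
have p_cst : {ae Leb R, forall t, C t -> p t - c = 0}.
  apply: fourier_uniqueness.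
  - have icst := sqint_integrable mC finC (sqint_cst mC finC c).
    by apply: eq_integrable (integrableB mC ip icst); [exact: mC|move=> t _].
  - move=> n; apply: mean_eq0.
    rewrite (@eq_mean _ _ _ (fun t => cos (n%:~R * t) * p t - c * cos (n%:~R * t))); last first.
      by move=> t _; rewrite mulrBr (mulrC c).
    rewrite (meanB mC (icp n) (ick n)) (meanZ mC c (ic1 n)).
    have [->|n0] := eqVneq n 0.
      have E1 : mean C (fun t => cos (0%:~R * t) * p t) = c.
        by apply: eq_mean => t _; rewrite mul0r cos0 mul1r.
      have E2 : mean C (fun t => cos (0%:~R * t)) = 1.
        by rewrite -[RHS]mean_cst; apply: eq_mean => t _; rewrite mul0r cos0.
      by rewrite E1 E2 mulr1 subrr.
    by rewrite mcp// [X in c * X](_ : _ = 0) ?mulr0 ?subrr// /mean int_cos ?mulr0.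
  - move=> n; apply: mean_eq0.
    rewrite (@eq_mean _ _ _ (fun t => sin (n%:~R * t) * p t - c * sin (n%:~R * t))); last first.
      by move=> t _; rewrite mulrBr (mulrC c).
    rewrite (meanB mC (isp n) (isk n)) (meanZ mC c (is1 n)) msp.
    by rewrite [X in c * X](_ : _ = 0) ?mulr0 ?subrr// /mean int_sin mulr0.
have [c0|c0] := eqVneq c 0; last first.
  (* p vanishes a.e. on J and equals c a.e. *)
  have : {ae Leb R, forall t, ~ J t}.
    apply: ae_LebS2 p_cst tJ => t pc tJ' Jt.
    have := pc (sJ Jt); rewrite /p tJ'// normc_sq /= expr0n /= addr0 sub0r.
    by move=> /eqP; rewrite oppr_eq0 (negbTE c0).
  move=> [N [mN N0 sub]].
  suff : (Leb R J <= Leb R N)%E by rewrite N0 leNgt J0.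
  apply: le_measure; rewrite ?inE//.
  by move=> t Jt; apply: sub => /=; apply.
have theta0 : {ae Leb R, forall t, C t -> theta t = 0}.
  apply: ae_LebS p_cst => t pc Ct; have := pc Ct.
  rewrite c0 subr0 /p normc_sq => /eqP.
  rewrite paddr_eq0 ?sqr_ge0// !sqrf_eq0 => /andP[/eqP h1 /eqP h2].
  exact: complex_eq.
have := t1; rewrite fourierE (rform_ae0 mC sC Lt (L2_monom R 0) theta0).
by move=> [/eqP]; rewrite eq_sym oner_eq0.
Qed.

(** A nonzero function of H^2 has a first nonzero coefficient; dividing by that
    power of z and by the coefficient gives an element of [K]. *)
Theorem hardy_uniqueness u : hardy2 u ->
  {ae Leb R, forall t, J t -> u t = 0} -> {ae Leb R, forall t, C t -> u t = 0}.
Proof.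
move=> Hu uJ; have Lu := hardy_L2 Hu.
have [u0|/existsNP[k0 /eqP k0P]] := pselect (forall n : nat, fourier u n%:Z = 0).
  apply: (fourier_inj Lu) => n; have [n0|n0] := ltP n 0; first exact: Hu.2.
  by rewrite -(gez0_abs n0); exact: u0.
have ex : exists k : nat, fourier u k%:Z != 0 by exists k0.
case: (ex_minnP ex) => k kP kmin.
pose v : R -> Rcomplex R := fun t => expi ((- k%:Z)%:~R * t) * u t.
have Lv : L2 C v by exact: L2_shift.
have vE n : fourier v n = fourier u (n + k%:Z) by rewrite fourier_shift opprK.
have Hv : hardy2 v.
  split => // n n0; rewrite vE.
  have [nk|nk] := ltP (n + k%:Z) 0; first exact: Hu.2.
  apply/eqP; rewrite -(gez0_abs nk); apply: contraTT isT => /kmin.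
  rewrite leqNgt => /negP; case.
  by rewrite -ltz_nat (gez0_abs nk) gtrDr.
exfalso; apply: (@K_empty (fun t => (fourier u k%:Z)^-1 * v t)); split.
- exact: hardyZ.
- by apply: ae_LebS uJ => t h /h ut; rewrite /v ut !mulr0.
- by rewrite (fourierZ _ _ Lv) vE add0r mulVf.
Qed.

End uniqueness.

End hardy.

(** * The Blaschke product on the circle *)
Section blaschke.
Variables (R : realType) (N : nat) (phi0 : R) (z_ : 'I_N -> R[i]).
Hypothesis z_disk : forall j, normc (z_ j) < 1.

Let expi_neq (t : R) j : expi t - z_ j != 0.
Proof.
apply/eqP => /subr0_eq tz; have := z_disk j; rewrite -tz.
by rewrite -(ltr_pXn2r (n := 2))// ?nnegrE ?normc_ge0// normc_expi expr1n ltxx.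
Qed.

Let expiJ (t : R) : expi t * conjc (expi t) = 1 :> R[i].
Proof. by rewrite conjc_expi -expiD subrr; apply: complex_eq; rewrite /= ?cos0 ?sin0. Qed.

Let expi0 (t : R) : expi t != 0 :> R[i].
Proof.
by apply/eqP => h; have := expiJ t; rewrite h mul0r => /eqP; rewrite eq_sym oner_eq0.
Qed.

(** On the circle 1 = z conj z, so that each factor of the product is a quotient
    w / (z conj w), of modulus 1. *)
Let factorE (t : R) j :
  1 - conjc (z_ j) * expi t = expi t * conjc (expi t - z_ j).
Proof. by rewrite rmorphB/= mulrBr expiJ mulrC. Qed.

Lemma blaschke_mulJ (t : R) :
  blaschke phi0 z_ (expi t) * conjc (blaschke phi0 z_ (expi t)) = 1.
Proof.
rewrite /blaschke rmorphM/= mulrACA expiJ mul1r rmorph_prod -big_split/=.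
apply: big1 => j _; rewrite factorE.
have w0 := expi_neq t j; move: (expi t - z_ j) w0 => w w0.
have wJ0 : conjc w != 0 by rewrite fmorph_eq0.
have zJ0 : conjc (expi t) != 0 :> R[i] by rewrite fmorph_eq0 expi0.
rewrite rmorphM/= fmorphV rmorphM/= conjcK.
have quot (F : fieldType) (a a' c c' : F) : a != 0 -> a' != 0 -> c != 0 -> c' != 0 ->
    a / (c * a') * (a' / (c' * a)) = (c * c')^-1.
  by move=> a0 a'0 c0 c'0; field; rewrite a0 a'0 c0 c'0.
by rewrite quot// ?expi0// expiJ invr1.
Qed.

Lemma cmeasurable_blaschke (A : set R) : lebesgue_measurable A ->
  cmeasurable_fun A (fun t => blaschke phi0 z_ (expi t)).
Proof.
move=> mA.
have mz : cmeasurable_fun A (@expi R).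
  by split; [exact: continuous_lebesgue_measurable mA (@continuous_cos R)|
             exact: continuous_lebesgue_measurable mA (@continuous_sin R)].
have mw j : cmeasurable_fun A (fun t => expi t - z_ j).
  exact: (cmeasurableB mz (cmeasurable_cst A (z_ j))).
(* the factor w / (z conj w) is w^2 conj z / |w|^2, with a real denominator *)
have mV j : cmeasurable_fun A (fun t => (normc (expi t - z_ j) ^+ 2)^-1%:C).
  split; last exact: measurable_cst.
  apply: (continuous_lebesgue_measurable mA) => t; apply: cvgV.
    rewrite expf_eq0/=; apply/negP => /eqP h.
    by have /negP := expi_neq t j; apply; apply/eqP; exact: ComplexField.Normc.eq0_normc h.
  have -> : (fun t => normc (expi t - z_ j) ^+ 2) =
      (fun t => (cos t - complex.Re (z_ j)) ^+ 2 + (sin t - complex.Im (z_ j)) ^+ 2).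
    by apply/funext => s; rewrite normc_sq !ReImE.
  rewrite normc_sq !ReImE /=; apply: cvgD.
    apply: (@cvg_comp _ _ _ _ (fun y : R => y ^+ 2)); last exact: exprn_continuous.
    by apply: cvgB; [exact: continuous_cos|exact: cvg_cst].
  apply: (@cvg_comp _ _ _ _ (fun y : R => y ^+ 2)); last exact: exprn_continuous.
  by apply: cvgB; [exact: continuous_sin|exact: cvg_cst].
have mf j : cmeasurable_fun A (fun t => (expi t - z_ j) / (1 - conjc (z_ j) * expi t)).
  have := cmeasurableM (cmeasurableM (cmeasurableM (mw j) (mw j)) (cmeasurableJ mz)) (mV j).
  congr (cmeasurable_fun A); apply/funext => t; rewrite factorE.
  have w0 := expi_neq t j; move: (expi t - z_ j) w0 => w w0.
  have wJ0 : conjc w != 0 by rewrite fmorph_eq0.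
  have -> : (normc w ^+ 2)^-1%:C = (w * conjc w)^-1.
    rewrite fmorphV; congr (_^-1); apply: complex_eq; rewrite ?ReImE normc_sq /=; ring.
  have quot (F : fieldType) (a a' c c' : F) : a != 0 -> a' != 0 -> c * c' = 1 ->
      a * a * c' * (a * a')^-1 = a / (c * a').
    move=> a0 a'0 cc; have c0 : c != 0.
      by apply: contra_eq_neq cc => ->; rewrite mul0r eq_sym oner_eq0.
    have -> : c' = c^-1 by rewrite -[LHS](mulKf c0) cc mulr1.
    by field; rewrite a0 a'0 c0.
  exact: quot.
have mp (s : seq 'I_N) : cmeasurable_fun A (fun t => \prod_(j <- s)
    ((expi t - z_ j) / (1 - conjc (z_ j) * expi t))).
  elim: s => [|j s IH].
    by have := cmeasurable_cst A 1; congr (cmeasurable_fun A); apply/funext => t; rewrite big_nil.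
  have := cmeasurableM (mf j) IH; congr (cmeasurable_fun A).
  by apply/funext => t; rewrite big_cons.
exact: (cmeasurableM (cmeasurable_cst A (expi phi0)) (mp _)).
Qed.

End blaschke.

(** * The extremal problem *)
Section extremal.
Variables (R : realType) (I J : set R).
Local Notation C := (circle R).
Local Notation mC := (@measurable_circle R).
Local Notation sC := (@subset_refl _ (circle R)).
Local Notation H := (@hardy2 R : set (R -> Rcomplex R)).
Local Notation L := (L2 C : set (R -> Rcomplex R)).
Hypotheses (mI : lebesgue_measurable I) (mJ : lebesgue_measurable J)
  (sI : I `<=` C) (sJ : J `<=` C) (IJ : I `|` J = C) (IJ0 : I `&` J = set0).
Implicit Types (u v w q g : R -> Rcomplex R).

Let psdI := rform_psd_circle mI sI.
Let psdJ := rform_psd_circle mJ sJ.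
Let psdC := rform_psd mC sC.

Let splitC u v : L u -> L v -> rform C u v = rform I u v + rform J u v.
Proof. exact: rform_setU mI mJ IJ IJ0. Qed.

(** For lam > 0 the weighted form is equivalent to the form of L^2. *)
Lemma weighted_proj lam q : 0 < lam -> L q -> exists2 x, hardy2 x &
  forall w, hardy2 w -> rform I (x - q) w + lam * rform J (x - q) w = 0.
Proof.
move=> lam0 Lq; have psdW := psd_form_add psdI psdJ (ltW lam0).
have eq1 u : L u ->
    rform C u u <= (1 + lam^-1) * (rform I u u + lam * rform J u u).
  move=> Lu; rewrite (splitC Lu Lu).
  have p0 := psd_ge0 psdI Lu; have q0 := psd_ge0 psdJ Lu.
  have -> : (1 + lam^-1) * (rform I u u + lam * rform J u u) =
    rform I u u + rform J u u + (lam * rform J u u + lam^-1 * rform I u u).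
    by field; rewrite gt_eqF.
  by rewrite lerDl addr_ge0// mulr_ge0// ?invr_ge0 ltW.
have eq2 u : L u ->
    rform I u u + lam * rform J u u <= (1 + lam) * rform C u u.
  move=> Lu; rewrite (splitC Lu Lu).
  have p0 := psd_ge0 psdI Lu; have q0 := psd_ge0 psdJ Lu.
  have -> : (1 + lam) * (rform I u u + rform J u u) =
    rform I u u + lam * rform J u u + (lam * rform I u u + rform J u u) by ring.
  by rewrite lerDl addr_ge0// mulr_ge0// ltW.
have C0 : 0 < 1 + lam^-1 by rewrite addr_gt0// invr_gt0.
have C0' : 0 < 1 + lam by rewrite addr_gt0.
pose W u v := rform I u v + lam * rform J u v.
have cW := @form_complete_equiv _ _ _ (rform C) W (psd_dom psdI) _ _
  eq1 eq2 C0 C0' (@rform_complete R).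
have clW := @form_closed_equiv _ _ _ (rform C) W (psd_dom psdI) _
  eq1 C0 _ (@hardy_L2 R) (@hardy_closed R).
exact: (orth_proj psdW cW (hardy_subspace R) (@hardy_L2 R) clW Lq).
Qed.

Lemma hardy_projP u v : L u -> is_hardy_proj u v <->
  hardy2 v /\ forall w, hardy2 w -> rform C v w = rform C u w.
Proof.
move=> Lu; split=> [[Hv h]|[Hv h]]; split => // w Hw.
- have := h w Hw; rewrite innerE => -[+ _].
  rewrite [X in X = _ -> _](psdBl psdC Lu (hardy_L2 Hv) (hardy_L2 Hw)).
  by move/subr0_eq.
- have Hiw := hardyZ 'i Hw; rewrite innerE; congr Complex.
    rewrite [LHS](psdBl psdC Lu (hardy_L2 Hv) (hardy_L2 Hw)).
    by rewrite h// subrr.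
  rewrite [LHS](psdBl psdC Lu (hardy_L2 Hv) (hardy_L2 Hiw)).
  by rewrite h// subrr.
Qed.

Lemma PplusP u : L u ->
  hardy2 (Pplus u) /\ forall w, hardy2 w -> rform C (Pplus u) w = rform C u w.
Proof.
move=> Lu; apply/(hardy_projP _ Lu); apply: xgetPex.
have [x Hx xo] := orth_proj psdC (@rform_complete R) (hardy_subspace R)
  (@hardy_L2 R) (@hardy_closed R) Lu.
exists x; apply/(hardy_projP _ Lu); split => // w Hw.
by apply/eqP; rewrite -subr_eq0 -(psdBl psdC (hardy_L2 Hx) Lu (hardy_L2 Hw)) xo.
Qed.

Lemma toeplitzP g : hardy2 g -> hardy2 (toeplitz J g) /\
  forall w, hardy2 w -> rform C (toeplitz J g) w = rform J g w.
Proof.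
move=> Hg; have Lg := hardy_L2 Hg; have [Ht h] := PplusP (L2_indic mJ Lg).
split; first exact: Ht.
move=> w Hw; have Lw := hardy_L2 Hw.
have Lj := L2_indic mJ Lg.
by rewrite /toeplitz h// (psd_sym psdC Lj Lw) (rform_indic _ _ sJ) (psd_sym psdJ Lw Lg).
Qed.

(** Both sides of the equation of the resolvent lie in H^2, so it may be tested
    against H^2. There [toeplitz J] acts as the multiplication by the indicator of
    [J], so that the left-hand side becomes rform I + (1 + mu) rform J; the
    right-hand side becomes the same form of [q], by the assumption on [s]. *)
Lemma resolventP mu s q : -1 < mu -> L s -> L q ->
  (forall w, L w -> rform C s w = rform I q w + (1 + mu) * rform J q w) ->
  hardy2 (resolvent J mu (Pplus s)) /\ forall w, hardy2 w ->
    rform I (resolvent J mu (Pplus s) - q) w +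
    (1 + mu) * rform J (resolvent J mu (Pplus s) - q) w = 0.
Proof.
move=> mu1 Ls Lq sq; have [HU UE] := PplusP Ls; set U := Pplus s in HU UE *.
have char g : hardy2 g ->
    (ae_eq (Leb R) C (fun t => g t + mu%:C * toeplitz J g t) U <->
     forall w, hardy2 w -> rform I (g - q) w + (1 + mu) * rform J (g - q) w = 0).
  move=> Hg; have [Ht tE] := toeplitzP Hg.
  pose d : R -> Rcomplex R := (mu *: (toeplitz J g : R -> Rcomplex R) + g) - (U : R -> Rcomplex R).
  have Hd : hardy2 d.
    by apply: (subspaceB (hardy_subspace R)) HU; exact: (hardy_subspace R).2.
  have dE w : hardy2 w -> rform C d w =
      rform I (g - q) w + (1 + mu) * rform J (g - q) w.
    move=> Hw; have Lw := hardy_L2 Hw; have Lg := hardy_L2 Hg.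
    have Lt := hardy_L2 Ht; have LU := hardy_L2 HU.
    rewrite (psdBl psdC _ LU Lw); last exact: (hardy_L2 ((hardy_subspace R).2 _ _ _ Ht Hg)).
    rewrite (psd_lin psdC mu Lt Lg Lw) tE// UE// (sq w Lw) (splitC Lg Lw).
    by rewrite (psdBl psdI Lg Lq Lw) (psdBl psdJ Lg Lq Lw); ring.
  have dt t : d t = g t + mu%:C * toeplitz J g t - U t.
    have scE (x : R[i]) : mu *: (x : Rcomplex R) = mu%:C * x.
      by apply: complex_eq; rewrite !ReImE /=; ring.
    by rewrite -scE [g t + _]addrC.
  split=> [h w Hw|h].
    rewrite -dE//; apply: (rform_ae0 mC sC (hardy_L2 Hd) (hardy_L2 Hw)).
    by apply: ae_LebS h => t h Ct; rewrite dt h// subrr.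
  have : rform C d d = 0 by rewrite dE// h.
  move/(rform_eq0 mC sC (hardy_L2 Hd)); apply: ae_LebS => t h' Ct.
  by apply: subr0_eq; rewrite -dt h'.
have [|x Hx xo] := weighted_proj (lam := 1 + mu) _ Lq.
  by rewrite -ltrBlDl sub0r.
have [Hg gE] : [set g | hardy2 g /\
    ae_eq (Leb R) C (fun t => g t + mu%:C * toeplitz J g t) U] (resolvent J mu U).
  by apply: xgetPex; exists x; split => //; apply/(char x Hx).
by split => //; apply/char.
Qed.

(** The linear form w |-> - <g - q, w>_J is represented, for the weighted product,
    by - lam^-1 (g - q) restricted to [J]; [k] is the projection of that function. *)
Lemma derivative_direction lam g q : 0 < lam -> L g -> L q -> exists2 k, hardy2 k &
  forall w, hardy2 w -> rform I k w + lam * rform J k w = - rform J (g - q) w.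
Proof.
move=> lam0 Lg Lq; have Lgq := subspaceB (psd_dom psdI) Lg Lq.
pose p : R -> Rcomplex R := - lam^-1 *: ((fun t => (\1_J t)%:C * (g - q) t) : R -> Rcomplex R).
have Lj := L2_indic mJ Lgq.
have Lp : L p := subspaceZ (psd_dom psdI) (- lam^-1) Lj.
have [k Hk ko] := weighted_proj lam0 Lp; exists k => // w Hw.
have Lk := hardy_L2 Hk; have Lw := hardy_L2 Hw.
have := ko w Hw; rewrite (psdBl psdI Lk Lp Lw) (psdBl psdJ Lk Lp Lw).
have -> : rform I p w = 0.
  rewrite (psdZl psdI _ Lj Lw) [X in _ * X](_ : _ = 0) ?mulr0//.
  rewrite [LHS](@eq_mean _ I _ (fun=> 0)) => [|t It].
    by rewrite /mean Rintegral_cst ?mul0r ?mulr0.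
  rewrite indicE memNset; last by move=> Jt; have : (I `&` J) t by []; rewrite IJ0.
  by rewrite !ReImE /=; ring.
have -> : rform J p w = - lam^-1 * rform J (g - q) w.
  rewrite (psdZl psdJ _ Lj Lw); congr (_ * _); apply: eq_mean => t Jt.
  by rewrite indicE mem_set// !ReImE /=; ring.
by move=> h; apply/eqP; rewrite -subr_eq0 -[X in _ == X]h; apply/eqP; field; rewrite gt_eqF.
Qed.

(** If [k] has norm 0 then g - q is orthogonal to H^2 on [J], hence on [I]. So
    the function equal to g - q on [I] and to 0 on [J] has no Fourier coefficient
    of index n >= 0; its conjugate belongs to H^2 and vanishes on [J]. *)
Lemma derivative_direction_gt0 lam g q k : (0 < Leb R J)%E -> 0 < lam ->
  hardy2 g -> L q -> hardy2 k ->
  (forall w, hardy2 w -> rform I (g - q) w + lam * rform J (g - q) w = 0) ->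
  (forall w, hardy2 w -> rform I k w + lam * rform J k w = - rform J (g - q) w) ->
  ~ {ae Leb R, forall t, I t -> g t = q t} ->
  0 < rform I k k + lam * rform J k k.
Proof.
move=> J0 lam0 Hg Lq Hk go ko ngq; have Lk := hardy_L2 Hk.
have kI := psd_ge0 psdI Lk; have kJ := psd_ge0 psdJ Lk.
have lkJ : 0 <= lam * rform J k k by rewrite mulr_ge0// ltW.
rewrite lt0r addr_ge0// andbT; apply/negP => /eqP nk0; apply: ngq.
have kI0 : rform I k k = 0 by lra.
have kJ0 : rform J k k = 0.
  have /eqP : lam * rform J k k = 0 by lra.
  by rewrite mulf_eq0 gt_eqF//= => /eqP.
have Lgq := subspaceB (psd_dom psdI) (hardy_L2 Hg) Lq.
have CS0 (A : set R) (psdA : psd_form L (rform A)) w : L w ->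
    rform A k k = 0 -> rform A k w = 0.
  move=> Lw k0; have := psd_CS psdA Lk Lw; rewrite k0 mul0r => h.
  by apply/eqP; rewrite -sqrf_eq0 eq_le h sqr_ge0.
have gJ w : hardy2 w -> rform J (g - q) w = 0.
  move=> Hw; have Lw := hardy_L2 Hw; have := ko w Hw.
  rewrite (CS0 I psdI w Lw kI0) (CS0 J psdJ w Lw kJ0) mulr0 addr0.
  by move=> /esym/eqP; rewrite oppr_eq0 => /eqP.
have gI w : hardy2 w -> rform I (g - q) w = 0.
  by move=> Hw; have := go w Hw; rewrite gJ// mulr0 addr0.
pose s : R -> Rcomplex R := fun t => (\1_I t)%:C * (g - q) t.
have Ls : L s := L2_indic mI Lgq.
have so w : hardy2 w -> rform C s w = 0.
  move=> Hw; have Lw := hardy_L2 Hw.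
  rewrite (psd_sym psdC Ls Lw) (rform_indic _ _ sI) (psd_sym psdI Lw Lgq).
  exact: gI.
have HsJ : hardy2 (fun t => conjc (s t)).
  split; first exact: (L2J mC Ls).
  move=> n n0; apply: (fourier_conj_eq0 Ls); apply/fourier_eq0.
  have Hm : hardy2 (monom R (- n)) by apply: hardy_monom; rewrite oppr_ge0 ltW.
  by split; apply: so; [exact: Hm|exact: (hardyZ 'i Hm)].
have sJ0 : {ae Leb R, forall t, J t -> conjc (s t) = 0}.
  apply: aeW => t Jt; rewrite /s indicE memNset ?mul0r ?rmorph0//.
  by move=> It; have : (I `&` J) t by []; rewrite IJ0.
have := hardy_uniqueness mJ sJ J0 HsJ sJ0; apply: ae_LebS => t st It.
have := st (sI It); rewrite /s indicE mem_set// mul1r => h.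
by apply: subr0_eq; rewrite -[LHS]conjcK h rmorph0.
Qed.

End extremal.

Theorem proposition7 (R : realType) (I J : set R)
    (mI : lebesgue_measurable I) (mJ : lebesgue_measurable J)
    (IT : I `<=` circle R) (JE : J = circle R `\` I)
    (I_gt0 : (0 < Leb R I)%E) (J_gt0 : (0 < Leb R J)%E)
    (N : nat) (z_ omega_ : 'I_N -> R[i])
    (z_inj : injective z_) (z_disk : forall j, normc (z_ j) < 1)
    (phi0 : R) (phi0_ge0 : 0 <= phi0) (phi0_le : phi0 <= 2 * pi)
    (psi : R -> R[i]) (psiH : hardy2 psi)
    (psi_interp : forall j, disk_value psi (z_ j) = omega_ j)
    (f h : R -> R[i]) :
  let b := fun t => blaschke phi0 z_ (expi t) in
  L2 I f -> ~ trace I (interp psi b) f -> L2 J h ->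
  let g0 := fun mu : R => resolvent J mu (Pplus (vee I
    (fun t => conjc (b t) * (f t - psi t))
    (fun t => (1 + mu%:C) * conjc (b t) * (h t - psi t)))) in
  let M0 := fun mu : R => normL2 J (fun t => psi t + b t * g0 mu t - h t) in
  let e := fun mu : R => normL2 I (fun t => psi t + b t * g0 mu t - f t) ^+ 2 in
  let M0sq := fun mu : R => M0 mu ^+ 2 in
  forall mu : R, -1 < mu ->
    [/\ derivable e mu 1, derivable M0sq mu 1,
        0 < derive1 e mu, derive1 M0sq mu < 0
      & derive1 e mu = - (mu + 1) * derive1 M0sq mu].
Proof.
move=> b Lf ntr Lh g0 M0 e M0sq mu mu1.
have mC := @measurable_circle R.
have sJ : J `<=` circle R by rewrite JE; exact: subDsetl.
have IJ : I `|` J = circle R by rewrite JE setDUK.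
have IJ0 : I `&` J = set0 by rewrite JE setDIK.
have bJ t : b t * conjc (b t) = 1 by exact: blaschke_mulJ.
have nb t : normc (b t) ^+ 2 = 1.
  by have := congr1 (@complex.Re R) (bJ t); rewrite normc_sq !ReImE /= mulrN opprK -!expr2.
have mbI : cmeasurable_fun I b by exact: cmeasurable_blaschke.
have mbJ : cmeasurable_fun J b by exact: cmeasurable_blaschke.
have nbJ t : normc (conjc (b t)) ^+ 2 <= 1 by rewrite -[leRHS](nb t) !normc_sq !ReImE sqrrN.
have Lpsi := psiH.1.
have LI : L2 I (fun t => conjc (b t) * (f t - psi t)).
  exact: (L2_mul mI (cmeasurableJ mbI) (fun t _ => nbJ t) (L2B mI Lf (L2S mC mI IT Lpsi))).
have LJ : L2 J (fun t => conjc (b t) * (h t - psi t)).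
  exact: (L2_mul mJ (cmeasurableJ mbJ) (fun t _ => nbJ t) (L2B mJ Lh (L2S mC mJ sJ Lpsi))).
pose q : R -> Rcomplex R := vee I (fun t => conjc (b t) * (f t - psi t))
  (fun t => conjc (b t) * (h t - psi t)).
have Lq : L2 (circle R) q := L2_vee mI mJ IJ IJ0 LI LJ.
have notI t : J t -> (t \in I) = false.
  by move=> Jt; apply/negP; rewrite inE => It; have : (I `&` J) t by []; rewrite IJ0.
have qI t : I t -> q t = conjc (b t) * (f t - psi t) by move=> It; rewrite /q /vee mem_set.
have qJ t : J t -> q t = conjc (b t) * (h t - psi t) by move=> Jt; rewrite /q /vee notI.
pose s (nu : R) : R -> Rcomplex R := vee I (fun t => conjc (b t) * (f t - psi t))
  (fun t => (1 + nu%:C) * conjc (b t) * (h t - psi t)).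
have Ls nu : L2 (circle R) (s nu).
  apply: (L2_vee mI mJ IJ IJ0 LI).
  have := L2Z mJ (1 + nu%:C) LJ; congr L2.
  by apply/funext => t; rewrite mulrA.
have psdI := rform_psd_circle mI IT; have psdJ := rform_psd_circle mJ sJ.
have sq nu w : L2 (circle R) w ->
    rform (circle R) (s nu) w = rform I q w + (1 + nu) * rform J q w.
  move=> Lw; rewrite (rform_setU mI mJ IJ IJ0 (Ls nu) Lw); congr (_ + _).
    by apply: eq_mean => t It; rewrite qI// /s /vee mem_set.
  rewrite -(psdZl psdJ _ Lq Lw); apply: eq_mean => t Jt.
  have -> : s nu t = (1 + nu) *: q t.
    rewrite qJ// /s /vee notI//; apply: complex_eq; rewrite !ReImE /=; ring.
  by [].
have gP nu : -1 < nu -> hardy2 (g0 nu) /\ forall w, hardy2 w ->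
    rform I ((g0 nu : R -> Rcomplex R) - q) w
      + (1 + nu) * rform J ((g0 nu : R -> Rcomplex R) - q) w = 0.
  move=> nu1; exact: (resolventP mI mJ IT sJ IJ IJ0 nu1 (Ls nu) Lq (sq nu)).
pose G (l : R) : R -> Rcomplex R := g0 (l - 1).
have lam0 : 0 < 1 + mu by rewrite -ltrBlDl sub0r.
have KG l : 0 < l -> hardy2 (G l) by move=> l0; apply: (gP (l - 1) _).1; lra.
have GO l w : 0 < l -> hardy2 w -> rform I (G l - q) w + l * rform J (G l - q) w = 0.
  move=> l0 Hw; have l1 : -1 < l - 1 by lra.
  by have := (gP _ l1).2 w Hw; rewrite [1 + _]addrC subrK.
have GE nu : G (1 + nu) = g0 nu by rewrite /G addrC addKr.
have [k Hk ko] := derivative_direction mI mJ IT sJ IJ IJ0 lam0 (hardy_L2 (KG _ lam0)) Lq.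
have nk_gt0 : 0 < rform I k k + (1 + mu) * rform J k k.
  apply: (derivative_direction_gt0 mI mJ IT sJ IJ0 J_gt0 lam0 (KG _ lam0) Lq Hk
    (fun w => GO _ w lam0) ko) => gq; apply: ntr.
  exists (fun t => psi t + b t * G (1 + mu) t); first by exists (G (1 + mu)); [exact: KG|].
  apply: ae_LebS gq => t gq It.
  by rewrite (gq It) (qI t It) mulrA bJ mul1r addrC subrK.
have [dQ dP] := weighted_derive psdI psdJ (hardy_subspace R) (@hardy_L2 R) Lq KG GO lam0 Hk ko.
have pt (A : set R) (u : R -> R[i]) nu : (forall t, A t -> q t = conjc (b t) * (u t - psi t)) ->
    normL2 A (fun t => psi t + b t * g0 nu t - u t) ^+ 2 =
    rform A (G (1 + nu) - q) (G (1 + nu) - q).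
  move=> qA; rewrite normL2_sq !rformxx GE; apply: eq_mean => t At.
  transitivity (normc (g0 nu t - conjc (b t) * (u t - psi t)) ^+ 2); last by rewrite -(qA t At).
  have -> : psi t + b t * g0 nu t - u t = b t * (g0 nu t - conjc (b t) * (u t - psi t)).
    by rewrite mulrBr mulrA bJ mul1r opprB addrAC addrC addrA.
  by rewrite normc_sqM nb mul1r.
have eE : e = (fun nu => rform I (G (1 + nu) - q) (G (1 + nu) - q)).
  by apply/funext => nu; exact: pt.
have ME : M0sq = (fun nu => rform J (G (1 + nu) - q) (G (1 + nu) - q)).
  by apply/funext => nu; exact: pt.
have de := is_derive_translate dP; rewrite -eE in de.
have dM := is_derive_translate dQ; rewrite -ME in dM.
rewrite !derive1E (derive_val (is_derive := de)) (derive_val (is_derive := dM)); split.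
- exact: ex_derive.
- exact: ex_derive.
- by rewrite !mulr_gt0.
- by rewrite oppr_lt0 mulr_gt0.
- by ring.
Qed.
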